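(* Suppose that the level set $\Omega=\{x\in\mathbb{R}^n: f(x)\le f(x_0)\}$ is bounded, that $\gamma\le 1/2$, that $\alpha\le 1/2$, and that there exists $L_H>0$ such that $\|\nabla^2f(x)-\nabla^2f(y)\|\le L_H\|x-y\|$ for all $x,y\in\Omega+B(0,r_1)$, where $r_1:=\frac{\bar{\mathcal{C}}U_g^{1-\gamma}n}{c_2s}$. Consider any $\delta\in(0,1)$ and $\varepsilon>0$. Let $$m=\left\lfloor\frac{f(x_0)-f^*}{(1-\delta)(1-\delta_s)\,p\,\varepsilon^2}\right\rfloor+1,\qquad\text{where}\qquad p=\frac{\alpha\,t_{\min}}{2\bar{\mathcal{C}}(1+c_1)\frac{n}{s}U_H+2c_2U_g^{\gamma}},$$ and where $\delta_s=2\left(\exp(-\frac{\mathcal{C}_0}{4}s)+\exp(-s)\right)$. Then $$\sqrt{\frac{f(x_0)-f^*}{m\,p}}\ \ge\ \min_{k=0,1,\dots,m-1}\|g_k\|$$ holds with probability at least $1-\exp\left(-\frac{\delta^2}{2}(1-\delta_s)m\right)$.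
   Context: Algorithm (RS-RNM, randomized subspace regularized Newton method). $f:\mathbb{R}^n\to\mathbb{R}$ is twice continuously differentiable and $s<n$ is a positive integer. Parameters: $x_0\in\mathbb{R}^n$, $\gamma\ge 0$, $c_1>1$, $c_2>0$, $\alpha,\beta\in(0,1)$. At each iteration $k=0,1,2,\dots$ one independently samples a random matrix $P_k\in\mathbb{R}^{s\times n}$ whose entries are i.i.d. $\mathrm{N}(0,1/s)$. With $g_k=\nabla f(x_k)$, $H_k=\nabla^2 f(x_k)$, set $\Lambda_k=\max(0,-\lambda_{\min}(P_kH_kP_k^\top))$, $\eta_k=c_1\Lambda_k+c_2\|g_k\|^\gamma$, $M_k=P_kH_kP_k^\top+\eta_kI_s$, $d_k=-P_k^\top M_k^{-1}P_kg_k$. Let $l_k\ge 0$ be the smallest integer with $f(x_k)-f(x_k+\beta^{l_k}d_k)\ge -\alpha\beta^{l_k}g_k^\top d_k$ (Armijo's rule), $t_k=\beta^{l_k}$, $x_{k+1}=x_k+t_kd_k$. Norms are Euclidean / spectral. Constants. $\mathcal{C}_0>0$ is an absolute constant such that for every random matrix $P\in\mathbb{R}^{s\times n}$ with i.i.d. $\mathrm{N}(0,1/s)$ entries, every $x\in\mathbb{R}^n$ and $\epsilon\in(0,1)$, $(1-\epsilon)\|x\|^2\le\|Px\|^2\le(1+\epsilon)\|x\|^2$ with probability at least $1-2\exp(-\mathcal{C}_0\epsilon^2 s)$. $\bar{\mathcal{C}}>0$ is a constant such that $\|PP^\top\|\le\bar{\mathcal{C}}\frac{n}{s}$ with probability at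 least $1-2e^{-s}$. When $\Omega$ is bounded: $f^*=\inf_{x\in\Omega}f(x)$; $U_g>0$ is a constant with $\|g_k\|\le U_g$ for all $k\ge0$ (it exists because all iterates lie in $\Omega$); $B(0,r)$ is the ball of radius $r$ centred at $0$; $U_H>0$ is a constant with $\|\nabla^2f(x)\|\le U_H$ for all $x\in\Omega+B(0,r_1)$; and $$t_{\min}=\min\left(1,\frac{\beta c_2^2s^2}{\bar{\mathcal{C}}^2L_HU_g^{1-2\gamma}n^2}\right).$$ *)

(* Defs.v *)
From mathcomp Require Import all_boot all_order all_algebra.
From mathcomp Require Import all_classical all_reals all_analysis.

Set Implicit Arguments.
Unset Strict Implicit.
Unset Printing Implicit Defensive.

Import Order.TTheory GRing.Theory Num.Theory.
Import numFieldNormedType.Exports.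

Local Open Scope classical_set_scope.
Local Open Scope ring_scope.

(* Vectors of R^n are columns.  The library norm `|x| on matrices is the
   sup norm, so the Euclidean and spectral norms are introduced here; the
   topology, differentiability and boundedness they induce are the library
   ones. *)

Section Euclidean.
Context {R : realType}.

Definition dot (n : nat) (u v : 'cV[R]_n) : R := (u^T *m v) 0 0.

Definition enorm (n : nat) (u : 'cV[R]_n) : R := Num.sqrt (dot u u).

Definition opnorm (m n : nat) (A : 'M[R]_(m, n)) : R :=
  sup [set enorm (A *m v) | v in [set v : 'cV[R]_n | enorm v <= 1]].

(* Meant for real symmetric matrices of positive size, whose set of real
   eigenvalues is finite and nonempty, so that the infimum is attained. *)
Definition lambda_min (n : nat) (A : 'M[R]_n) : R :=
  inf [set a : R | eigenvalue A a].

Definition add_ball (n : nat) (A : set 'cV[R]_n) (r : R) : set 'cV[R]_n :=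
  [set x + y | x in A & y in [set y | enorm y < r]].

Definition grad (n : nat) (f : 'cV[R]_n -> R) (x : 'cV[R]_n) : 'cV[R]_n :=
  \col_i 'D_(delta_mx i 0) f x.

Definition hessian (n : nat) (f : 'cV[R]_n -> R) (x : 'cV[R]_n) : 'M[R]_n :=
  \matrix_(i, j) 'D_(delta_mx i 0) (fun y => 'D_(delta_mx j 0) f y) x.

Definition twice_continuously_differentiable (n : nat)
    (f : 'cV[R]_n -> R) : Prop :=
  [/\ forall x, differentiable f x,
      forall x, differentiable (grad f) x
    & continuous (hessian f)].

End Euclidean.

Section GaussianMatrices.
Context {d : measure_display} {T : measurableType d} {R : realType}.
Context (Pr : probability T R).

Definition mutually_independent (I : eqType) (X : I -> {RV Pr >-> R}) : Prop :=
  forall (J : seq I) (B : I -> set R),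
    uniq J -> (forall i, measurable (B i)) ->
    Pr (\bigcap_(i in [set` J]) (X i @^-1` B i)) =
    (\big[*%E/1%E]_(i <- J) Pr (X i @^-1` B i))%E.

(* The second parameter of normal_prob is the standard deviation. *)
Definition iid_normal (I : eqType) (X : I -> {RV Pr >-> R}) (sigma : R) : Prop :=
  (forall i (B : set R), measurable B ->
     distribution Pr (X i) B = normal_prob 0 sigma B) /\
  mutually_independent X.

Definition rmx (s n : nat) (P : 'I_s -> 'I_n -> {RV Pr >-> R}) (w : T) :
    'M[R]_(s, n) :=
  \matrix_(i, j) P i j w.

Definition gaussian_mx (s n : nat) (P : 'I_s -> 'I_n -> {RV Pr >-> R}) : Prop :=
  iid_normal (fun ij : 'I_s * 'I_n => P ij.1 ij.2) (Num.sqrt s%:R)^-1.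

(* Independence of the family of all the entries of all the matrices amounts
   to independence of the matrices together with independence of the entries
   within each of them. *)
Definition gaussian_mx_seq (s n : nat)
    (P : nat -> 'I_s -> 'I_n -> {RV Pr >-> R}) : Prop :=
  iid_normal (fun kij : nat * ('I_s * 'I_n) => P kij.1 kij.2.1 kij.2.2)
    (Num.sqrt s%:R)^-1.

End GaussianMatrices.

(* C0 is absolute: one value serves all the dimensions s and n. *)
Definition embedding_constant (R : realType) (C0 : R) : Prop :=
  0 < C0 /\
  forall (s n : nat) (d : measure_display) (T : measurableType d)
    (Pr : probability T R) (P : 'I_s -> 'I_n -> {RV Pr >-> R})
    (x : 'cV[R]_n) (e : R),
    (0 < s)%N -> (0 < n)%N -> gaussian_mx P -> 0 < e -> e < 1 ->
    ((1 - 2 * expR (- (C0 * e ^+ 2 * s%:R)))%:E <=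
     Pr [set w | ((1 - e) * enorm x ^+ 2 <= enorm (rmx P w *m x) ^+ 2)%R
                 /\ (enorm (rmx P w *m x) ^+ 2 <= (1 + e) * enorm x ^+ 2)%R])%E.

Definition gram_norm_constant (R : realType) (s n : nat) (Cbar : R) : Prop :=
  0 < Cbar /\
  forall (d : measure_display) (T : measurableType d)
    (Pr : probability T R) (P : 'I_s -> 'I_n -> {RV Pr >-> R}),
    gaussian_mx P ->
    ((1 - 2 * expR (- s%:R))%:E <=
     Pr [set w | (opnorm (rmx P w *m (rmx P w)^T) <= Cbar * (n%:R / s%:R))%R])%E.

Section Algorithm.
Context {R : realType} (n s : nat) (f : 'cV[R]_n -> R).
Context (gamma c1 c2 alpha beta : R).
Implicit Types (P : 'M[R]_(s, n)) (x d : 'cV[R]_n).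

Definition sketched_hessian P x : 'M[R]_s := P *m hessian f x *m P^T.

Definition Lambda P x : R := Num.max 0 (- lambda_min (sketched_hessian P x)).

(* powR satisfies 0 `^ 0 = 1, so eta = c1 * Lambda + c2 when gamma = 0. *)
Definition eta P x : R := c1 * Lambda P x + c2 * enorm (grad f x) `^ gamma.

Definition regularized_hessian P x : 'M[R]_s :=
  sketched_hessian P x + (eta P x)%:M.

(* regularized_hessian P x is invertible unless grad f x = 0, in which case
   the direction is 0 whatever value invmx takes. *)
Definition direction P x : 'cV[R]_n :=
  - (P^T *m invmx (regularized_hessian P x) *m P *m grad f x).

Definition armijo x d (l : nat) : Prop :=
  - (alpha * beta ^+ l * dot (grad f x) d) <= f x - f (x + beta ^+ l *: d).

Definition least_armijo x d (l : nat) : Prop :=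
  armijo x d l /\ forall j, armijo x d j -> (l <= j)%N.

Definition rs_rnm (x0 : 'cV[R]_n) (P : nat -> 'M[R]_(s, n))
    (x : nat -> 'cV[R]_n) : Prop :=
  x 0%N = x0 /\
  forall k, exists2 l, least_armijo (x k) (direction (P k) (x k)) l &
    x k.+1 = x k + beta ^+ l *: direction (P k) (x k).

End Algorithm.

Section Constants.
Context {R : realType} (n s : nat).

Definition level_set (f : 'cV[R]_n -> R) (x0 : 'cV[R]_n) : set 'cV[R]_n :=
  [set x | f x <= f x0].

Definition radius1 (gamma c2 Cbar Ug : R) : R :=
  Cbar * Ug `^ (1 - gamma) * n%:R / (c2 * s%:R).

Definition tmin (gamma c2 beta Cbar Ug LH : R) : R :=
  Num.min 1 (beta * c2 ^+ 2 * s%:R ^+ 2 /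
             (Cbar ^+ 2 * LH * Ug `^ (1 - 2 * gamma) * n%:R ^+ 2)).

Definition pconst (gamma c1 c2 alpha beta Cbar Ug UH LH : R) : R :=
  alpha * tmin gamma c2 beta Cbar Ug LH /
  (2 * Cbar * (1 + c1) * (n%:R / s%:R) * UH + 2 * c2 * Ug `^ gamma).

Definition delta_s (C0 : R) : R :=
  2 * (expR (- (C0 / 4 * s%:R)) + expR (- s%:R)).

End Constants.

(* Main.v *)
Require Import Defs.
From HB Require Import structures.
From mathcomp Require Import all_boot all_order all_algebra.
From mathcomp Require Import all_classical all_reals all_analysis measurable_realfun.
From mathcomp Require Import ring lra.

Set Implicit Arguments.
Unset Strict Implicit.
Unset Printing Implicit Defensive.

Import Order.TTheory GRing.Theory Num.Theory.
Import numFieldNormedType.Exports.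

Local Open Scope classical_set_scope.
Local Open Scope ring_scope.

(** Write g_k for the gradient at x_k, u_k = g_k / |g_k|, D = f x0 - fstar, and
    call step k good when |P_k P_k^T| <= Cbar n / s.

    On every step the regularised sketched Hessian M_k is at least
    c2 |g_k|^gamma, so f never increases. On a good step M_k is also at most
    B = Cbar (n/s) (1 + c1) UH + c2 Ug^gamma, the direction stays within the
    radius on which the Hessian is Lipschitz, and Armijo's rule accepts a
    length of at least tmin. Hence f decreases by at least
    alpha tmin |P_k g_k|^2 / B = 2 p |P_k u_k|^2 |g_k|^2 ([step_decrease]).

    Let X_k be |P_k u_k|^2 on good steps and 0 elsewhere ([gain]). Summing the
    decreases gives 2 p \sum_k X_k |g_k|^2 <= D. If all the |g_k| with k < m
    exceed sqrt (D / (m p)), it follows that \sum_(k < m) X_k <= m / 2, whereas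
    the X_k are close to 1 on average. Counting the steps with
    |P_k u_k|^2 >= 1/2 would lose a factor (1 - delta) (1 - delta_s) in the
    threshold, so the deviation is estimated from exponential moments of the
    X_k themselves. The matrix P_k is independent of everything that determines
    u_k ([decoupling]), so conditionally on the past s |P_k u_k|^2 is a
    chi-square variable with s degrees of freedom, and
    E exp (- s X_k / 2) <= 2^(- s / 2) + 2 e^(- s) ([exp_moment_step]).
    Markov's inequality then bounds the probability of failure by
    (e^(s / 4) (2^(- s / 2) + 2 e^(- s)))^m, which for s >= 6 is at most
    e^(- m / 2) ([total_gain_tail]) and a fortiori at most
    exp (- delta^2 (1 - delta_s) m / 2).

    When s <= 5 the claim is void, because 1 - delta_s <= 0
    ([embedding_dim_ge6]). Indeed C0 serves all dimensions: applied to columns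
    of height r, it bounds the probability that a chi-square variable with r
    degrees of freedom is at least twice its mean by 2 exp (- C0 e^2 r) for
    every e < 1, while Cramer's change of measure bounds this probability below
    by an explicit exponential ([chi2_upper_tail]). Letting r grow yields an
    upper bound on C0 ([embedding_constant_ub]). *)

(** * Euclidean geometry *)

Section Euclid.
Context {R : realType}.
Implicit Types n m k : nat.

Lemma dotE n (u v : 'cV[R]_n) : dot u v = \sum_i u i 0 * v i 0.
Proof. by rewrite /dot mxE; apply: eq_bigr => i _; rewrite mxE. Qed.

Lemma dotC n (u v : 'cV[R]_n) : dot u v = dot v u.
Proof. by rewrite !dotE; apply: eq_bigr => i _; rewrite mulrC. Qed.

Lemma dotDr n (u v w : 'cV[R]_n) : dot u (v + w) = dot u v + dot u w.
Proof. by rewrite /dot mulmxDr mxE. Qed.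

Lemma dotZr n (a : R) (u v : 'cV[R]_n) : dot u (a *: v) = a * dot u v.
Proof. by rewrite /dot -scalemxAr mxE. Qed.

Lemma dotNr n (u v : 'cV[R]_n) : dot u (- v) = - dot u v.
Proof. by rewrite /dot mulmxN mxE. Qed.

Lemma dotDl n (u v w : 'cV[R]_n) : dot (v + w) u = dot v u + dot w u.
Proof. by rewrite dotC dotDr !(dotC u). Qed.

Lemma dotZl n (a : R) (u v : 'cV[R]_n) : dot (a *: v) u = a * dot v u.
Proof. by rewrite dotC dotZr dotC. Qed.

Lemma dotNl n (u v : 'cV[R]_n) : dot (- v) u = - dot v u.
Proof. by rewrite dotC dotNr dotC. Qed.

Lemma dotBr n (u v w : 'cV[R]_n) : dot u (v - w) = dot u v - dot u w.
Proof. by rewrite dotDr dotNr. Qed.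

Lemma dot0r n (u : 'cV[R]_n) : dot u 0 = 0.
Proof. by rewrite /dot mulmx0 mxE. Qed.

Lemma dot_mull m n (A : 'M[R]_(m, n)) u v : dot (A *m u) v = dot u (A^T *m v).
Proof. by rewrite /dot trmx_mul mulmxA. Qed.

Lemma dot_mulr m n (A : 'M[R]_(m, n)) u v : dot u (A *m v) = dot (A^T *m u) v.
Proof. by rewrite dot_mull trmxK. Qed.

Lemma dot_ge0 n (u : 'cV[R]_n) : 0 <= dot u u.
Proof. by rewrite dotE; apply: sumr_ge0 => i _; rewrite -expr2 sqr_ge0. Qed.

Lemma dot_eq0 n (u : 'cV[R]_n) : (dot u u == 0) = (u == 0).
Proof.
apply/eqP/eqP => [|->]; last exact: dot0r.
rewrite dotE => H; apply/colP => i; rewrite mxE; apply/eqP.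
have pos j : xpredT j -> 0 <= u j 0 * u j 0 by rewrite -expr2 sqr_ge0.
by have /eqP := psumr_eq0P pos H (erefl true : xpredT i); rewrite mulf_eq0 orbb.
Qed.

Lemma enorm2 n (u : 'cV[R]_n) : enorm u ^+ 2 = dot u u.
Proof. by rewrite /enorm sqr_sqrtr // dot_ge0. Qed.

Lemma enorm_ge0 n (u : 'cV[R]_n) : 0 <= enorm u.
Proof. exact: sqrtr_ge0. Qed.

Lemma enorm_eq0 n (u : 'cV[R]_n) : (enorm u == 0) = (u == 0).
Proof. by rewrite -dot_eq0 -enorm2 expf_eq0. Qed.

Lemma enorm_gt0 n (u : 'cV[R]_n) : (0 < enorm u) = (u != 0).
Proof. by rewrite lt0r enorm_ge0 andbT enorm_eq0. Qed.

Lemma enorm0 n : enorm (0 : 'cV[R]_n) = 0.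
Proof. by apply/eqP; rewrite enorm_eq0. Qed.

Lemma enormZ n a (u : 'cV[R]_n) : enorm (a *: u) = `|a| * enorm u.
Proof.
by rewrite /enorm dotZl dotZr mulrA -expr2 sqrtrM ?sqr_ge0 // sqrtr_sqr.
Qed.

Lemma enormN n (u : 'cV[R]_n) : enorm (- u) = enorm u.
Proof. by rewrite /enorm dotNl dotNr opprK. Qed.

(** Along u + t v the form is a nonnegative polynomial in t: its discriminant is
    nonpositive and, if it degenerates to an affine function, its slope is 0. *)
Lemma psd_cauchy_schwarz n (A : 'M[R]_n) (u v : 'cV[R]_n) : A^T = A ->
  (forall z, 0 <= dot z (A *m z)) ->
  dot u (A *m v) ^+ 2 <= dot u (A *m u) * dot v (A *m v).
Proof.
move=> Asym psd.
have sym x y : dot x (A *m y) = dot y (A *m x) by rewrite dot_mulr Asym dotC.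
have quad t : 0 <= dot u (A *m u) + 2 * t * dot u (A *m v) + t ^+ 2 * dot v (A *m v).
  have := psd (u + t *: v).
  rewrite mulmxDr -scalemxAr !dotDr !dotDl !dotZr !dotZl (sym v u).
  by congr (0 <= _); ring.
have [v0|] := eqVneq (dot v (A *m v)) 0.
  rewrite v0 mulr0; have [->|c0] := eqVneq (dot u (A *m v)) 0; first by rewrite expr0n.
  have := quad (- (dot u (A *m u) + 1) / (2 * dot u (A *m v))).
  rewrite v0 mulr0 addr0; set p := dot u (A *m u); set c := dot u (A *m v) in c0 *.
  have -> : p + 2 * (- (p + 1) / (2 * c)) * c = - 1 by field.
  by rewrite ler0N1.
move=> vn0; have v0 : 0 < dot v (A *m v) by rewrite lt0r vn0 psd.
have := quad (- dot u (A *m v) / dot v (A *m v)).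
move: (dot u (A *m u)) (dot v (A *m v)) (dot u (A *m v)) v0 => p q c q0.
have -> : p + 2 * (- c / q) * c + (- c / q) ^+ 2 * q = (p * q - c ^+ 2) / q.
  by field; rewrite gt_eqF.
by rewrite pmulr_lge0 ?invr_gt0 // subr_ge0.
Qed.

Lemma cauchy_schwarz n (u v : 'cV[R]_n) : `|dot u v| <= enorm u * enorm v.
Proof.
have := @psd_cauchy_schwarz n 1%:M u v (trmx1 _ _).
rewrite !mul1mx => H.
rewrite -[leLHS]ger0_norm // -ler_sqr ?nnegrE ?mulr_ge0 ?enorm_ge0 //.
rewrite normr_id -normrX ger0_norm ?sqr_ge0 // exprMn !enorm2; apply: H => z.
by rewrite mul1mx dot_ge0.
Qed.

(** This makes the supremum defining [opnorm] finite. *)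
Lemma enorm_mul_le m n (A : 'M[R]_(m, n)) (v : 'cV[R]_n) :
  enorm (A *m v) <= Num.sqrt (\sum_i \sum_j A i j ^+ 2) * enorm v.
Proof.
have S0 : 0 <= \sum_i \sum_j A i j ^+ 2.
  by apply: sumr_ge0 => i _; apply: sumr_ge0 => j _; exact: sqr_ge0.
rewrite -ler_sqr ?nnegrE ?mulr_ge0 ?sqrtr_ge0 //.
rewrite exprMn (sqr_sqrtr S0) [leLHS]enorm2 dotE mulr_suml; apply: ler_sum => i _; rewrite -expr2.
have -> : (A *m v) i 0 = dot (row i A)^T v.
  by rewrite dotE mxE; apply: eq_bigr => j _; rewrite !mxE.
have -> : \sum_j A i j ^+ 2 = enorm (row i A)^T ^+ 2.
  by rewrite enorm2 dotE; apply: eq_bigr => j _; rewrite !mxE.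
rewrite -exprMn -[leLHS]ger0_norm ?sqr_ge0 // normrX.
by rewrite lerXn2r ?nnegrE ?mulr_ge0 ?enorm_ge0 // cauchy_schwarz.
Qed.

Lemma opnorm_has_sup m n (A : 'M[R]_(m, n)) :
  has_sup [set enorm (A *m v) | v in [set v : 'cV[R]_n | enorm v <= 1]].
Proof.
split; first by exists (enorm (A *m 0)), 0 => //=; rewrite enorm0.
exists (Num.sqrt (\sum_i \sum_j A i j ^+ 2)) => _ /= [v v1 <-].
by apply: le_trans (enorm_mul_le A v) _; rewrite ler_piMr // sqrtr_ge0.
Qed.

Lemma enorm_mul_opnorm m n (A : 'M[R]_(m, n)) v :
  enorm (A *m v) <= opnorm A * enorm v.
Proof.
have [->|v0] := eqVneq v 0; first by rewrite mulmx0 !enorm0 mulr0.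
have nv : 0 < enorm v by rewrite enorm_gt0.
rewrite -ler_pdivrMr //.
have -> : enorm (A *m v) / enorm v = enorm (A *m ((enorm v)^-1 *: v)).
  by rewrite -scalemxAr enormZ ger0_norm ?invr_ge0 ?enorm_ge0 // mulrC.
apply: ub_le_sup; first exact: (opnorm_has_sup A).2.
exists ((enorm v)^-1 *: v) => //=.
by rewrite enormZ ger0_norm ?invr_ge0 ?enorm_ge0 // mulVf // gt_eqF.
Qed.

Lemma opnorm_le m n (A : 'M[R]_(m, n)) c : 0 <= c ->
  (forall v, enorm (A *m v) <= c * enorm v) -> opnorm A <= c.
Proof.
move=> c0 H; apply: ge_sup => [|_ /= [v v1 <-]]; first exact: (opnorm_has_sup A).1.
by apply: le_trans (H v) _; rewrite ler_piMr.
Qed.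

Lemma dot_mul_opnorm m n (A : 'M[R]_(m, n)) u v :
  `|dot u (A *m v)| <= opnorm A * enorm u * enorm v.
Proof.
apply: le_trans (cauchy_schwarz _ _) _.
by rewrite [opnorm A * _]mulrC -mulrA ler_wpM2l ?enorm_ge0 // enorm_mul_opnorm.
Qed.

End Euclid.

Section LambdaMin.
Context {R : realType}.

Lemma continuous_big_sum (V : topologicalType) (I : Type) (r : seq I)
    (F : I -> V -> R) :
  (forall i, continuous (F i)) -> continuous (fun x => \sum_(i <- r) F i x).
Proof.
move=> cF x; elim: r => [|i r ih].
  under eq_fun do rewrite big_nil.
  exact: cvg_cst.
under eq_fun do rewrite big_cons.
by apply: continuousD; [exact: cF|exact: ih].
Qed.

Lemma norm_coord_le m n (M : 'M[R]_(m, n)) i j : `|M i j| <= `|M|.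
Proof.
rewrite -[leRHS]/(mx_norm M) mx_normrE.
by apply/bigmax_geP; right => /=; exists (i, j).
Qed.

Lemma norm_mx_le m n (M : 'M[R]_(m, n)) e : 0 <= e ->
  (forall i j, `|M i j| <= e) -> `|M| <= e.
Proof.
by move=> e0 H; rewrite -[leLHS]/(mx_norm M) mx_normrE; apply/bigmax_leP; split.
Qed.

Lemma norm_tr m n (M : 'M[R]_(m, n)) : `|M^T| = `|M|.
Proof.
have le_tr k l (N : 'M[R]_(k, l)) : `|N^T| <= `|N|.
  by apply: norm_mx_le => // i j; rewrite mxE norm_coord_le.
by apply/eqP; rewrite eq_le le_tr -{1}[M]trmxK le_tr.
Qed.

Lemma continuous_tr m n : continuous (@trmx R m n).
Proof.
move=> M U /= /(nbhs_ballP M^T) [e e0 eU]; apply/nbhs_ballP; exists e => //= N.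
by move=> [_ MN]; apply: eU; split => // i j; rewrite !mxE; exact: MN.
Qed.

(** Transposition carries the statement over from row vectors. *)
Lemma bounded_closed_compact_cV n (A : set 'cV[R]_n) :
  bounded_set A -> closed A -> compact A.
Proof.
move=> bA cA.
have -> : A = trmx @` (trmx @^-1` A : set 'rV[R]_n).
  apply/seteqP; split=> [x Ax|_ [y Ay <-]//].
  by exists x^T; rewrite /= trmxK.
apply: continuous_compact; first by apply: continuous_subspaceT; exact: continuous_tr.
apply: bounded_closed_compact.
  have [M [Mr HM]] := bA; exists M; split => // e Me x Ax.
  by have /= := HM e Me x^T Ax; rewrite norm_tr.
by apply: closed_comp cA => x _; exact: continuous_tr.
Qed.

Lemma continuous_dot_mul n (A : 'M[R]_n) : continuous (fun v : 'cV[R]_n => dot v (A *m v)).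
Proof.
have -> : (fun v : 'cV[R]_n => dot v (A *m v)) =
    (fun v => \sum_i \sum_j v i 0 * (A i j * v j 0)).
  apply/funext => v; rewrite dotE; apply: eq_bigr => i _.
  by rewrite mxE mulr_sumr.
apply: continuous_big_sum => i; apply: continuous_big_sum => j v.
have cc k : continuous (fun v : 'cV[R]_n => v k 0) by exact: coord_continuous.
apply: (@continuousM _ _ (fun v : 'cV[R]_n => v i 0) (fun v => A i j * v j 0)).
  exact: cc.
apply: (@continuousM _ _ (fun=> A i j) (fun v : 'cV[R]_n => v j 0)).
  exact: cst_continuous.
exact: cc.
Qed.

(** By homogeneity it suffices to minimise over the compact unit sphere. *)
Lemma rayleigh_min n (A : 'M[R]_n.+1) : exists2 v : 'cV[R]_n.+1,
  dot v v = 1 & forall u, dot v (A *m v) * dot u u <= dot u (A *m u).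
Proof.
have cdot : continuous (fun v : 'cV[R]_n.+1 => dot v v).
  by have := @continuous_dot_mul _ (1%:M : 'M[R]_n.+1); under eq_fun do rewrite mul1mx.
pose S := [set v : 'cV[R]_n.+1 | dot v v = 1].
have cS : compact S.
  apply: bounded_closed_compact_cV.
    exists 1; split => // e e1 v Sv; apply: le_trans (ltW e1).
    apply: norm_mx_le => // i j; rewrite (ord1 j) -(@expr_le1 _ 2) //.
    rewrite -normrX ger0_norm ?sqr_ge0 // -Sv dotE (bigD1 i) //= expr2 lerDl.
    by apply: sumr_ge0 => k _; rewrite -expr2 sqr_ge0.
  rewrite (_ : S = (fun v => dot v v) @^-1` [set x : R | x = 1]) //.
  by apply: closed_comp => [x _|]; [exact: cdot|exact: closed_eq].
have S0 : S !=set0.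
  exists (delta_mx 0 0); rewrite /S /= dotE (bigD1 0) //= !mxE !eqxx mulr1.
  by rewrite big1 ?addr0 // => i i0; rewrite mxE (negbTE i0) mul0r.
have cf : {within S, continuous (fun v : 'cV[R]_n.+1 => dot v (A *m v))}.
  by apply: continuous_subspaceT; exact: continuous_dot_mul.
have [v /[!inE] vS vmin] := compact_EVT_min S0 cS cf; exists v => // u.
have [->|u0] := eqVneq u 0; first by rewrite mulmx0 !dot0r mulr0.
have uu : 0 < dot u u by rewrite lt0r dot_eq0 u0 dot_ge0.
have := vmin ((enorm u)^-1 *: u); rewrite inE /S /=.
rewrite -scalemxAr !dotZl !dotZr !mulrA -expr2 exprVn enorm2.
by rewrite mulVf ?gt_eqF // => /(_ erefl); rewrite mulrC ler_pdivlMr.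
Qed.

(** The minimum of the Rayleigh quotient is an eigenvalue by the first order
    condition, and no eigenvalue lies below it. *)
Lemma lambda_minE n (A : 'M[R]_n.+1) : A^T = A -> exists2 v : 'cV[R]_n.+1,
  dot v v = 1 & lambda_min A = dot v (A *m v) /\
  forall u, lambda_min A * dot u u <= dot u (A *m u).
Proof.
move=> Asym; have [v v1 vmin] := rayleigh_min A; set mu := dot v (A *m v) in vmin.
suff E : lambda_min A = mu by exists v => //; rewrite E.
pose B := A - mu%:M.
have BE u : dot u (B *m u) = dot u (A *m u) - mu * dot u u.
  by rewrite /B mulmxBl mul_scalar_mx dotBr dotZr.
have Bsym : B^T = B by rewrite /B linearB /= Asym tr_scalar_mx.
have Bpsd u : 0 <= dot u (B *m u) by rewrite BE subr_ge0.
have Bv : B *m v = 0.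
  apply/eqP; rewrite -dot_eq0 -sqrf_eq0 eq_le sqr_ge0 andbT.
  have := psd_cauchy_schwarz (B *m v) v Bsym Bpsd.
  by rewrite [dot v (B *m v)]BE v1 mulr1 subrr mulr0.
have Av : A *m v = mu *: v.
  by apply/eqP; rewrite -subr_eq0 -mul_scalar_mx -mulmxBl Bv.
have v0 : v != 0 by rewrite -dot_eq0 v1 oner_eq0.
have eig : [set a | eigenvalue A a] mu.
  apply/eigenvalueP; exists v^T; last by rewrite -trmx0 (inj_eq trmx_inj).
  by rewrite -{1}Asym -trmx_mul Av linearZ.
have lb : lbound [set a | eigenvalue A a] mu.
  move=> a /eigenvalueP[u uA u0].
  have Au : A *m u^T = a *: u^T by rewrite -{1}Asym -trmx_mul uA linearZ.
  have := vmin u^T; rewrite Au dotZr ler_pM2r // lt0r dot_ge0 andbT dot_eq0.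
  by rewrite -trmx0 (inj_eq trmx_inj).
apply/eqP; rewrite eq_le; apply/andP; split.
  by apply: ge_inf => //; exists mu.
by apply: lb_le_inf => //; exists mu.
Qed.

Lemma lambda_min_quad n (A : 'M[R]_n) u : A^T = A ->
  lambda_min A * dot u u <= dot u (A *m u).
Proof.
case: n A u => [A u _|n A u /lambda_minE[v _ [_ ]]] //.
by rewrite !dotE !big_ord0 mulr0.
Qed.

Lemma le_lambda_min n (A : 'M[R]_n) a : (0 < n)%N -> A^T = A ->
  (a <= lambda_min A) <-> (forall u, a * dot u u <= dot u (A *m u)).
Proof.
case: n A => // n A _ Asym; split=> [aA u|H].
  apply: le_trans (lambda_min_quad u Asym).
  by rewrite ler_wpM2r ?dot_ge0.
have [v v1 [-> _]] := lambda_minE Asym.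
by have := H v; rewrite v1 mulr1.
Qed.

End LambdaMin.

(** * Second order calculus *)

Section Lines.
Context {R : realType} {n : nat}.
Implicit Types (g : 'cV[R]_n -> R) (x d : 'cV[R]_n).

Lemma derive_coords g x d : differentiable g x ->
  'D_d g x = \sum_i d i 0 * 'D_(delta_mx i 0) g x.
Proof.
move=> dg; rewrite deriveE // {1}(matrix_sum_delta d) linear_sum.
apply: eq_bigr => i _; rewrite big_ord1 linearZ /= deriveE //.
Qed.

Lemma is_derive_line g x d (t : R) : (forall y, differentiable g y) ->
  is_derive t 1 (fun u : R => g (x + u *: d)) ('D_d g (x + t *: d)).
Proof.
move=> dg.
have E : (fun h : R => h^-1 *: (g (x + (h *: 1 + t) *: d) - g (x + t *: d))) =
    (fun h => h^-1 *: (g (h *: d + (x + t *: d)) - g (x + t *: d))).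
  apply/funext => h; congr (_ *: (g _ - _)).
  by rewrite scalerDl [h *: 1]mulr1 addrCA.
have dv : derivable g (x + t *: d) d by exact: diff_derivable.
apply: DeriveDef; first by rewrite /derivable /= E.
by rewrite /derive /= E.
Qed.

Lemma continuous_line g x d : (forall y, differentiable g y) ->
  continuous (fun u : R => g (x + u *: d)).
Proof.
move=> dg t; apply: differentiable_continuous; apply/derivable1_diffP.
by case: (@is_derive_line g x d t dg).
Qed.

Lemma mvt_line g x d (h : R) : (forall y, differentiable g y) -> 0 < h ->
  exists2 c, 0 < c < h & g (x + h *: d) - g x = h * 'D_d g (x + c *: d).
Proof.
move=> dg h0.
have [c ch E] := @MVT R (fun u : R => g (x + u *: d))
  (fun u => 'D_d g (x + u *: d)) 0 h h0
  (fun t _ => @is_derive_line g x d t dg)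
  (continuous_subspaceT (@continuous_line g x d dg)).
exists c; first by rewrite in_itv /= in ch.
by move: E; rewrite scale0r addr0 subr0 mulrC.
Qed.

End Lines.

Section Hessian.
Context {R : realType} {n : nat} {f : 'cV[R]_n -> R}.
Hypothesis f_C2 : twice_continuously_differentiable f.

Let df x : differentiable f x. Proof. by case: f_C2. Qed.

Let dfj j x : differentiable (fun y => 'D_(delta_mx j 0) f y) x.
Proof.
have [_ dgrad _] := f_C2.
have -> : (fun y => 'D_(delta_mx j 0) f y) = (fun M : 'cV[R]_n => M j 0) \o grad f.
  by apply/funext => y; rewrite /= mxE.
by apply: differentiable_comp => //; exact: differentiable_coord.
Qed.

Lemma derive_grad x d : 'D_d f x = dot (grad f x) d.
Proof.
by rewrite derive_coords // dotE; apply: eq_bigr => i _; rewrite mxE mulrC.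
Qed.

(** The mean value theorem is applied along i, then along j. As the left-hand
    side is symmetric in i and j, so is a continuous Hessian. *)
Lemma second_difference x i j (h : R) : 0 < h -> exists2 y, `|x - y| < 2 * h &
  f (x + h *: delta_mx i 0 + h *: delta_mx j 0) - f (x + h *: delta_mx i 0)
  - (f (x + h *: delta_mx j 0) - f x) = h ^+ 2 * hessian f y j i.
Proof.
move=> h0; set ei : 'cV[R]_n := delta_mx i 0; set ej : 'cV[R]_n := delta_mx j 0.
pose G (u : R) := f (x + h *: ej + u *: ei) - f (x + u *: ei).
have dG (u : R) : is_derive u 1 G
    ('D_ei f (x + h *: ej + u *: ei) - 'D_ei f (x + u *: ei)).
  by apply: is_deriveB; exact: is_derive_line.
have cG : {within `[0, h], continuous G}.
  apply: continuous_subspaceT => u; apply: differentiable_continuous.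
  by apply/derivable1_diffP; case: (dG u).
have [c ch E] := MVT h0 (fun u _ => dG u) cG.
have [b bh E'] := @mvt_line _ _ _ (x + c *: ei) ej h (dfj i) h0.
exists (x + c *: ei + b *: ej).
  move: ch; rewrite in_itv /= => /andP[c0 ch]; case/andP: bh => b0 bh.
  have -> : x - (x + c *: ei + b *: ej) = - (c *: ei + b *: ej).
    by rewrite -addrA opprD addNKr.
  rewrite normrN (le_lt_trans (ler_normD _ _)) // !normrZ !gtr0_norm //.
  have nd k : `|delta_mx k 0 : 'cV[R]_n| <= 1.
    apply: norm_mx_le => // a b'; rewrite mxE; case: (_ && _) => /=.
      by rewrite normr1.
    by rewrite normr0.
  have := nd i; have := nd j; rewrite -/ei -/ej => nj ni.
  have : c * `|ei| <= c by rewrite ler_piMr // ltW.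
  have : b * `|ej| <= b by rewrite ler_piMr // ltW.
  lra.
transitivity (G h - G 0).
  by rewrite /G scale0r !addr0 [x + _ + _]addrAC; congr (_ - _ - _).
rewrite E subr0 [x + _ + _]addrAC E' /hessian mxE expr2 mulrC mulrA //.
Qed.

Lemma hessian_sym x : (hessian f x)^T = hessian f x.
Proof.
have cont k l : continuous (fun y => hessian f y k l).
  have [_ _ cH] := f_C2.
  move=> y; apply: (continuous_comp (cH y) (g := fun M : 'M[R]_n => M k l)).
  exact: coord_continuous.
have diff := second_difference.
(* Generalising the Hessian to H prevents unification from unfolding it into
   iterated derivatives. *)
suff sym (H : 'cV[R]_n -> 'M[R]_n) :
    (forall k l, continuous (fun y => H y k l)) ->
    (forall x i j (h : R), 0 < h -> exists2 y, `|x - y| < 2 * h &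
      f (x + h *: delta_mx i 0 + h *: delta_mx j 0) - f (x + h *: delta_mx i 0)
      - (f (x + h *: delta_mx j 0) - f x) = h ^+ 2 * H y j i) ->
    (H x)^T = H x.
  exact: sym cont diff.
move=> {cont diff} cont diff.
apply/matrixP => i j; rewrite [LHS]mxE; apply/eqP; rewrite -subr_eq0 -normr_le0.
apply/ler_addgt0Pr => e e0; rewrite add0r.
have e20 : 0 < e / 2 by rewrite divr_gt0.
have near k l : exists2 r, 0 < r & forall y, `|x - y| < r ->
    `|H x k l - H y k l| < e / 2.
  have /cvgrPdist_lt/(_ _ e20)/nbhs_ballP[r r0 Hr] := cont k l x.
  by exists r => // y xy; apply: Hr; rewrite /= mx_norm_ball.
have [r1 r10 H1] := near i j; have [r2 r20 H2] := near j i.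
pose h := Num.min r1 r2 / 2.
have h0 : 0 < h by rewrite divr_gt0 // lt_min r10.
have hr1 : 2 * h <= r1 by rewrite /h mulrC divfK // ge_min lexx.
have hr2 : 2 * h <= r2 by rewrite /h mulrC divfK // ge_min lexx orbT.
have [y xy E] := diff x i j h h0.
have [z xz E'] := diff x j i h h0.
have yz : H z i j = H y j i.
  have h20 : h ^+ 2 != 0 by rewrite expf_neq0 // gt_eqF.
  apply: (mulfI h20); rewrite -E -E'.
  by rewrite [x + h *: delta_mx j 0 + _]addrAC; ring.
have := H1 z (lt_le_trans xz hr1); have := H2 y (lt_le_trans xy hr2).
rewrite yz [X in _ -> X < _ -> _]distrC => b2 b1.
apply: le_trans (ler_distD (H y j i) _ _) _.
by apply: le_trans (lerD (ltW b2) (ltW b1)) _; rewrite -splitr.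
Qed.

Lemma derive_grad_line x d y :
  'D_d (fun z => dot (grad f z) y) x = dot d (hessian f x *m y).
Proof.
have E : (fun z => dot (grad f z) y) =
    \sum_i (fun z => y i 0 * 'D_(delta_mx i 0) f z).
  apply/funext => z; rewrite fct_sumE dotE; apply: eq_bigr => i _.
  by rewrite mxE mulrC.
have dE i : differentiable (fun z => y i 0 * 'D_(delta_mx i 0) f z) x.
  by apply: differentiableM => //; exact: differentiable_cst.
rewrite E derive_sum => [|i]; last exact: diff_derivable.
rewrite dotE; under [RHS]eq_bigr do rewrite mxE mulr_sumr.
rewrite exchange_big /=; apply: eq_bigr => j _.
have -> : (fun z => y j 0 * 'D_(delta_mx j 0) f z) =
    y j 0 *: (fun z => 'D_(delta_mx j 0) f z) by [].
rewrite deriveZ; last exact: diff_derivable.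
rewrite derive_coords // scaler_sumr; apply: eq_bigr => i _.
by rewrite mxE [_ *: _]mulrC mulrA.
Qed.

Lemma differentiable_grad_dot y x : differentiable (fun z => dot (grad f z) y) x.
Proof.
have -> : (fun z => dot (grad f z) y) =
    \sum_i (fun z => y i 0 * 'D_(delta_mx i 0) f z).
  apply/funext => z; rewrite fct_sumE dotE; apply: eq_bigr => i _.
  by rewrite mxE mulrC.
apply: differentiable_sum => i.
by apply: differentiableM => //; exact: differentiable_cst.
Qed.

(** Two uses of the mean value theorem: the first bounds the slope of f along
    the segment by an affine function, the second compares f with the quadratic
    that has this slope. *)
Lemma taylor2_le x d (t c : R) : 0 < t ->
  (forall u, 0 < u < t -> dot d (hessian f (x + u *: d) *m d) <= c) ->
  f (x + t *: d) <= f x + t * dot (grad f x) d + t ^+ 2 * c / 2.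
Proof.
move=> t0 Hc.
have slope u : 0 < u -> u < t -> dot (grad f (x + u *: d)) d <= dot (grad f x) d + u * c.
  move=> u0 ut.
  have [v /andP[v0 vu]] := @mvt_line _ _ (fun z => dot (grad f z) d) x d u
    (differentiable_grad_dot d) u0.
  rewrite derive_grad_line => E.
  rewrite -lerBlDl E ler_pM2l // Hc // v0 /=; exact: lt_trans ut.
pose psi (u : R) := f (x + u *: d) - (u * dot (grad f x) d + u ^+ 2 * c / 2).
have dpsi (u : R) : is_derive u 1 psi
    ('D_d f (x + u *: d) - (dot (grad f x) d + u * c)).
  apply: is_deriveB; first exact: is_derive_line.
  have -> : (fun u : R => u * dot (grad f x) d + u ^+ 2 * c / 2) =
     (fun u : R => dot (grad f x) d *: u + (c / 2) *: (u ^+ 2)).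
    by apply/funext => v; rewrite /GRing.scale /=; ring.
  apply: is_derive_eq.
  rewrite -[_%:A + _]/(dot (grad f x) d * 1 + c / 2 * (u * 1 + u * 1)) !mulr1.
  by congr (_ + _); rewrite mulrDr -mulrDl -splitr mulrC.
have cpsi : {within `[0, t], continuous psi}.
  apply: continuous_subspaceT => u; apply: differentiable_continuous.
  by apply/derivable1_diffP; case: (dpsi u).
have [u ut E] := MVT t0 (fun u _ => dpsi u) cpsi.
move: ut; rewrite in_itv /= => /andP[u0 ut].
have : psi t - psi 0 <= 0.
  rewrite E subr0 mulr_le0_ge0 ?(ltW t0) // derive_grad subr_le0.
  exact: slope.
rewrite /psi scale0r addr0 mul0r expr0n /= !mul0r; lra.
Qed.

End Hessian.

(** * One step of the algorithm *)

Section SketchAlgebra.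
Context {R : realType} {s n : nat}.
Implicit Types (P : 'M[R]_(s, n)).

Lemma enorm_trmul_le P nu z : opnorm (P *m P^T) <= nu ->
  enorm (P^T *m z) ^+ 2 <= nu * enorm z ^+ 2.
Proof.
move=> Pnu; rewrite enorm2 dot_mull trmxK mulmxA.
apply: le_trans (ler_norm _) _; apply: le_trans (dot_mul_opnorm _ _ _) _.
by rewrite -mulrA -expr2 ler_wpM2r // sqr_ge0.
Qed.

(** P and its transpose have the same norm: |P v|^2 = v . P^T (P v) is at most
    |v| |P^T (P v)|, to which [enorm_trmul_le] applies. *)
Lemma enorm_mul_le_gram P nu v : opnorm (P *m P^T) <= nu ->
  enorm (P *m v) ^+ 2 <= nu * enorm v ^+ 2.
Proof.
move=> Pnu; have [->|Pv0] := eqVneq (enorm (P *m v)) 0.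
  rewrite expr0n mulr_ge0 ?sqr_ge0 //; apply: le_trans Pnu.
  by apply: ub_le_sup; [exact: (opnorm_has_sup _).2|exists 0 => /=;
    rewrite ?mulmx0 ?enorm0].
have Pv : 0 < enorm (P *m v) by rewrite lt0r Pv0 enorm_ge0.
rewrite -(ler_pM2r (exprn_gt0 2 Pv)) -expr2 -exprM.
rewrite [enorm (P *m v) ^+ (2 * 2)]exprM [enorm (P *m v) ^+ 2 in leLHS]enorm2.
rewrite [dot _ _ in leLHS]dot_mull.
apply: (@le_trans _ _ ((enorm v * enorm (P^T *m (P *m v))) ^+ 2)).
  rewrite -[leLHS]ger0_norm ?sqr_ge0 // normrX.
  by rewrite lerXn2r ?nnegrE ?mulr_ge0 ?enorm_ge0 // cauchy_schwarz.
rewrite exprMn [leLHS]mulrC [leRHS]mulrAC ler_wpM2r ?sqr_ge0 //.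
exact: enorm_trmul_le.
Qed.

(** Cauchy-Schwarz for the form of M at M y and y bounds |M y|^4 by
    (M y . M (M y)) (y . M y), whose first factor is at most B |M y|^2. *)
Lemma psd_image_le k (M : 'M[R]_k) (B : R) y : M^T = M ->
  (forall z, 0 <= dot z (M *m z)) ->
  (forall z, dot z (M *m z) <= B * dot z z) ->
  enorm (M *m y) ^+ 2 <= B * dot y (M *m y).
Proof.
move=> Msym psd MB; rewrite enorm2; set q := dot (M *m y) (M *m y).
have [->|q0] := eqVneq q 0.
  have [->|a0] := eqVneq (dot y (M *m y)) 0; first by rewrite mulr0.
  have ap : 0 < dot y (M *m y) by rewrite lt0r a0 psd.
  rewrite mulr_ge0 //; case: leP => // B0.
  have := lt_le_trans ap (MB y); rewrite ltNge => /negP[].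
  by rewrite mulr_le0_ge0 ?dot_ge0 // ltW.
have qp : 0 < q by rewrite lt0r q0 dot_ge0.
have := psd_cauchy_schwarz (M *m y) y Msym psd; rewrite -/q => cs.
rewrite -(ler_pM2r qp) -expr2; apply: le_trans cs _.
by rewrite mulrAC ler_wpM2r // MB.
Qed.

End SketchAlgebra.

Section Step.
Context {R : realType} {n s : nat}.
Context {f : 'cV[R]_n -> R} {x0 : 'cV[R]_n}.
Context {gamma c1 c2 alpha beta Cbar Ug LH UH : R}.
Hypotheses (s_gt0 : (0 < s)%N) (s_lt_n : (s < n)%N).
Hypothesis f_C2 : twice_continuously_differentiable f.
Hypotheses (gamma_ge0 : 0 <= gamma) (c1_gt1 : 1 < c1) (c2_gt0 : 0 < c2).
Hypotheses (alpha_gt0 : 0 < alpha) (beta_gt0 : 0 < beta) (beta_lt1 : beta < 1).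
Hypothesis Cbar_gt0 : 0 < Cbar.
Hypotheses (Ug_gt0 : 0 < Ug).
Hypotheses (gamma_le_half : gamma <= 1 / 2) (alpha_le_half : alpha <= 1 / 2).
Hypothesis LH_gt0 : 0 < LH.
Hypothesis UH_gt0 : 0 < UH.

Let gm1 : 0 <= 1 - gamma. Proof. have h : gamma <= 1 / 2 by []. lra. Qed.
Let gm2 : 0 <= 1 - 2 * gamma. Proof. have h : gamma <= 1 / 2 by []. lra. Qed.

Let nu : R := Cbar * (n%:R / s%:R).
Let Reg := add_ball (level_set f x0) (radius1 n s gamma c2 Cbar Ug).
Hypothesis LH_lip : forall y z, Reg y -> Reg z ->
  opnorm (hessian f y - hessian f z) <= LH * enorm (y - z).
Hypothesis UH_bound : forall y, Reg y -> opnorm (hessian f y) <= UH.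

Let n_gt0 : 0 < n%:R :> R. Proof. by rewrite ltr0n (leq_trans _ s_lt_n). Qed.
Let sR_gt0 : 0 < s%:R :> R. Proof. by rewrite ltr0n. Qed.
Let nu_gt0 : 0 < nu. Proof. by rewrite mulr_gt0 ?divr_gt0. Qed.

Let radiusE : radius1 n s gamma c2 Cbar Ug = nu * Ug `^ (1 - gamma) / c2.
Proof. by rewrite /radius1 /nu; field; rewrite (gt_eqF c2_gt0) (gt_eqF sR_gt0). Qed.

Let radius_gt0 : 0 < radius1 n s gamma c2 Cbar Ug.
Proof. by rewrite radiusE divr_gt0 // mulr_gt0 // powR_gt0. Qed.

Lemma level_in_region x : level_set f x0 x -> Reg x.
Proof. by move=> xO; exists x => //; exists 0; rewrite ?addr0 //= enorm0. Qed.

Section Direction.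
Variables (P : 'M[R]_(s, n)) (x : 'cV[R]_n).
Hypothesis g_neq0 : grad f x != 0.

Let g := grad f x.
Let A := sketched_hessian f P x.
Let M := regularized_hessian f gamma c1 c2 P x.
Let eta0 := c2 * enorm g `^ gamma.
Let y := invmx M *m (P *m g).
Let dd := direction f gamma c1 c2 P x.

Let gpos : 0 < enorm g. Proof. by rewrite enorm_gt0. Qed.

Let eta0_gt0 : 0 < eta0. Proof. by rewrite mulr_gt0 ?powR_gt0. Qed.

Let Asym : A^T = A.
Proof. by rewrite /A /sketched_hessian !trmx_mul trmxK (hessian_sym f_C2) mulmxA. Qed.

Let Lam_ge0 : 0 <= Lambda f P x.
Proof. by rewrite /Lambda le_max lexx. Qed.

Let ME z : dot z (M *m z) = dot z (A *m z) + (c1 * Lambda f P x + eta0) * dot z z.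
Proof. by rewrite /M /regularized_hessian mulmxDl mul_scalar_mx dotDr dotZr. Qed.

Let Msym : M^T = M.
Proof. by rewrite /M /regularized_hessian linearD /= Asym tr_scalar_mx. Qed.

(** A negative least eigenvalue - L of A is compensated by c1 L >= L, so the
    part eta0 of the regularisation is left. *)
Lemma regularized_ge z : eta0 * dot z z <= dot z (M *m z).
Proof.
rewrite ME; have := lambda_min_quad z Asym; have := dot_ge0 z.
have : - lambda_min A <= Lambda f P x by rewrite /Lambda le_max lexx orbT.
move: (dot z z) (dot z (A *m z)) (lambda_min A) (Lambda f P x) Lam_ge0 => q a l L L0 lL q0 la.
have : 0 <= (c1 - 1) * L * q by rewrite !mulr_ge0 // subr_ge0 ltW.
have : 0 <= (L + l) * q by rewrite mulr_ge0 // -lerBlDr sub0r.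
lra.
Qed.

Let Mpsd z : 0 <= dot z (M *m z).
Proof. by apply: le_trans (regularized_ge z); rewrite mulr_ge0 ?dot_ge0 ?ltW. Qed.

Lemma regularized_unit : M \in unitmx.
Proof.
rewrite unitmxE unitfE; apply/negP => /det0P[v v0 vM].
have Mv : M *m v^T = 0 by rewrite -[M]trmxK -trmx_mul Msym vM trmx0.
have := regularized_ge v^T; rewrite Mv dot0r pmulr_rle0 // => h.
have : dot v^T v^T == 0 by rewrite eq_le h dot_ge0.
by rewrite dot_eq0 -trmx0 (inj_eq trmx_inj) (negbTE v0).
Qed.

Let My : M *m y = P *m g.
Proof. by rewrite /y mulKVmx // regularized_unit. Qed.

Let ddE : dd = - (P^T *m y).
Proof. by rewrite /dd /direction /y -/M -/g !mulmxA. Qed.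

Let gdE : dot g dd = - dot y (M *m y).
Proof. by rewrite ddE dotNr dot_mulr trmxK -My dotC. Qed.

Lemma direction_descent : dot g dd <= 0.
Proof. by rewrite gdE oppr_le0. Qed.

Hypotheses (xO : level_set f x0 x) (good : opnorm (P *m P^T) <= nu) (gU : enorm g <= Ug).

Let Y := enorm y ^+ 2.
Let G := enorm g.

Let y_le : eta0 ^+ 2 * Y <= nu * G ^+ 2.
Proof.
apply: le_trans (enorm_mul_le_gram g good).
have h1 : eta0 * enorm y <= enorm (P *m g).
  have [->|y0] := eqVneq (enorm y) 0; first by rewrite mulr0 enorm_ge0.
  have yp : 0 < enorm y by rewrite lt0r y0 enorm_ge0.
  rewrite -(ler_pM2r yp) -mulrA -expr2 enorm2 [leRHS]mulrC.
  apply: le_trans (regularized_ge y) _; rewrite My.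
  by apply: le_trans (ler_norm _) _; exact: cauchy_schwarz.
rewrite -exprMn lerXn2r ?nnegrE ?enorm_ge0 //.
by rewrite mulr_ge0 ?enorm_ge0 // ltW.
Qed.

Let D := enorm dd.

Let D2_le : D ^+ 2 <= nu * Y.
Proof. by rewrite /D ddE enormN; exact: enorm_trmul_le. Qed.

Let D_le : eta0 * D <= nu * G.
Proof.
have pD : 0 <= eta0 * D := mulr_ge0 (ltW eta0_gt0) (enorm_ge0 dd).
have pG : 0 <= nu * G := mulr_ge0 (ltW nu_gt0) (enorm_ge0 g).
rewrite -ler_sqr ?nnegrE //.
rewrite [leLHS]exprMn [leRHS]exprMn; apply: (@le_trans _ _ (eta0 ^+ 2 * (nu * Y))).
  by rewrite ler_wpM2l ?sqr_ge0.
have -> : nu ^+ 2 * G ^+ 2 = nu * (nu * G ^+ 2) by rewrite expr2 mulrA.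
by rewrite mulrCA ler_wpM2l // ltW.
Qed.

Let G_split : G = G `^ gamma * G `^ (1 - gamma).
Proof.
rewrite -powRD; last by apply/implyP => _; rewrite (gt_eqF gpos).
by rewrite addrCA subrr addr0 powRr1 // ltW.
Qed.

Let q0 : 0 < G `^ gamma. Proof. by rewrite powR_gt0. Qed.

(** The direction is at most nu |g| / eta0 long, and |g| / |g|^gamma is an
    increasing function of |g| because gamma <= 1. *)
Let D_radius : D <= radius1 n s gamma c2 Cbar Ug.
Proof.
have h : G `^ (1 - gamma) <= Ug `^ (1 - gamma).
  by apply: ge0_ler_powR; rewrite ?nnegrE ?(ltW Ug_gt0) ?enorm_ge0.
rewrite radiusE ler_pdivlMr //.
have h1 : c2 * D <= nu * G `^ (1 - gamma).
  rewrite -(ler_pM2l q0) mulrA [_ * c2]mulrC (le_trans D_le) //.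
  by rewrite {1}G_split mulrCA.
by rewrite mulrC (le_trans h1) // ler_wpM2l // ltW.
Qed.

Let eta := c1 * Lambda f P x + eta0.

Let eta_ge : eta0 <= eta.
Proof. by rewrite /eta lerDr mulr_ge0 // ltW // (lt_trans ltr01). Qed.

Let a := dot y (M *m y).

Let dHd : dot dd (hessian f x *m dd) = a - eta * Y.
Proof.
rewrite /a ME /eta /Y enorm2 addrK ddE mulmxN dotNl dotNr opprK.
by rewrite dot_mull trmxK /A /sketched_hessian !mulmxA.
Qed.

Lemma segment_in_region t u : 0 <= u -> u < t -> t <= 1 -> Reg (x + u *: dd).
Proof.
move=> u0 ut t1; exists x => //; exists (u *: dd) => //=.
rewrite enormZ ger0_norm //.
apply: (@le_lt_trans _ _ (u * radius1 n s gamma c2 Cbar Ug)).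
  by rewrite ler_wpM2l.
by rewrite gtr_pMl // (lt_le_trans ut).
Qed.

Let taylor t : 0 < t -> t <= 1 ->
  f (x + t *: dd) <= f x - t * a + t ^+ 2 * (a - eta * Y + LH * t * D ^+ 3) / 2.
Proof.
move=> t0 t1; rewrite -dHd -mulrN -gdE.
apply: taylor2_le => // u /andP[u0 ut].
have -> : hessian f (x + u *: dd) = hessian f x + (hessian f (x + u *: dd) - hessian f x).
  by rewrite [RHS]addrC subrK.
rewrite mulmxDl dotDr lerD2l.
apply: le_trans (ler_norm _) _; apply: le_trans (dot_mul_opnorm _ _ _) _.
rewrite -mulrA -expr2 -/D.
have lip := LH_lip (segment_in_region (ltW u0) ut t1) (level_in_region xO).
have xux : enorm (x + u *: dd - x) = u * D.
  by rewrite [x + _]addrC addrK enormZ gtr0_norm.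
rewrite xux in lip.
have D0 : 0 <= D by exact: enorm_ge0.
apply: le_trans (ler_wpM2r (sqr_ge0 D) lip) _.
have -> : LH * (u * D) * D ^+ 2 = LH * u * D ^+ 3 by ring.
by rewrite ler_wpM2r ?exprn_ge0 // ler_wpM2l // ltW.
Qed.

(** The second derivative of f along the direction is y . M y - eta |y|^2. For
    t as below, the term eta |y|^2 absorbs the error LH t |dd|^3 due to the
    variation of the Hessian, and t^2 (y . M y) / 2 is at most half of the
    linear term t (y . M y), which alpha <= 1/2 allows for. *)
Lemma armijo_short t : 0 < t -> t <= 1 ->
  t * (nu ^+ 2 * LH * Ug `^ (1 - 2 * gamma)) <= c2 ^+ 2 ->
  - (alpha * t * dot g dd) <= f x - f (x + t *: dd).
Proof.
move=> t0 t1 tle.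
have Gle : G <= (G `^ gamma) ^+ 2 * Ug `^ (1 - 2 * gamma).
  have h : G `^ (1 - 2 * gamma) <= Ug `^ (1 - 2 * gamma).
    by apply: ge0_ler_powR; rewrite ?nnegrE ?(ltW Ug_gt0) ?enorm_ge0.
  apply: (@le_trans _ _ ((G `^ gamma) ^+ 2 * G `^ (1 - 2 * gamma))); last first.
    by rewrite ler_wpM2l ?sqr_ge0.
  have ok (u v : R) : (u + v == 0) ==> (G != 0).
    by apply/implyP => _; rewrite (gt_eqF gpos).
  rewrite expr2 -!powRD //.
  by rewrite (_ : gamma + gamma + (1 - 2 * gamma) = 1) ?powRr1 ?enorm_ge0 //; ring.
have D0 : 0 <= D by exact: enorm_ge0.
have Y0 : 0 <= Y by exact: sqr_ge0.
have cubic : LH * t * D ^+ 3 <= eta0 * Y.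
  rewrite -(ler_pM2l eta0_gt0).
  apply: (@le_trans _ _ (LH * t * (nu * G) * (nu * Y))).
    have -> : eta0 * (LH * t * D ^+ 3) = LH * t * ((eta0 * D) * D ^+ 2) by ring.
    rewrite -[leRHS]mulrA ler_wpM2l //; first by rewrite mulr_ge0 // ltW.
    by apply: ler_pM => //; [rewrite mulr_ge0 // ltW|exact: sqr_ge0].
  have -> : LH * t * (nu * G) * (nu * Y) = t * nu ^+ 2 * LH * G * Y by ring.
  rewrite [leRHS]mulrA ler_wpM2r //.
  apply: (@le_trans _ _ (t * nu ^+ 2 * LH * ((G `^ gamma) ^+ 2 * Ug `^ (1 - 2 * gamma)))).
    apply: ler_wpM2l => //; apply: mulr_ge0 (ltW LH_gt0).
    by apply: mulr_ge0 (ltW t0) (sqr_ge0 nu).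
  have -> : t * nu ^+ 2 * LH * ((G `^ gamma) ^+ 2 * Ug `^ (1 - 2 * gamma)) =
    (G `^ gamma) ^+ 2 * (t * (nu ^+ 2 * LH * Ug `^ (1 - 2 * gamma))) by ring.
  apply: (@le_trans _ _ ((G `^ gamma) ^+ 2 * c2 ^+ 2)).
    by rewrite ler_wpM2l ?sqr_ge0.
  by rewrite /eta0 -/G -exprMn mulrC -expr2.
have := taylor t0 t1; rewrite gdE -/a.
have a0 : 0 <= a by exact: Mpsd.
have eY : eta0 * Y <= eta * Y by rewrite ler_wpM2r.
move: (f (x + t *: dd)) (f x) => f1 f0 ub.
have : 0 <= t ^+ 2 * (eta * Y - LH * t * D ^+ 3).
  by rewrite mulr_ge0 ?sqr_ge0 // subr_ge0 (le_trans cubic).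
have : 0 <= t * (1 / 2 - alpha) * a by rewrite !mulr_ge0 ?(ltW t0) // subr_ge0.
have : 0 <= t * (1 - t) * a by rewrite !mulr_ge0 ?(ltW t0) // subr_ge0.
move: (eta * Y) (LH * t * D ^+ 3) ub => e1 e2 ub; lra.
Qed.

Let B := nu * (1 + c1) * UH + c2 * Ug `^ gamma.

Let A_abs z : `|dot z (A *m z)| <= nu * UH * dot z z.
Proof.
rewrite /A /sketched_hessian -!mulmxA dot_mulr.
apply: le_trans (dot_mul_opnorm _ _ _) _; rewrite -mulrA -expr2.
apply: (@le_trans _ _ (UH * (nu * enorm z ^+ 2))).
  apply: ler_pM; rewrite ?sqr_ge0 //.
  - by apply: le_trans (enorm_ge0 _) (_ : enorm (hessian f x *m 0) <= _);
      apply: ub_le_sup; [exact: (opnorm_has_sup _).2|exists 0 => //=; rewrite enorm0].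
  - by apply: UH_bound; exact: level_in_region.
  - exact: enorm_trmul_le.
by rewrite enorm2 mulrA [UH * nu]mulrC.
Qed.

Let M_le z : dot z (M *m z) <= B * dot z z.
Proof.
rewrite ME; have := A_abs z; have := dot_ge0 z.
have LamU : Lambda f P x <= nu * UH.
  rewrite /Lambda ge_max mulr_ge0 ?(ltW nu_gt0) ?(ltW UH_gt0) //= lerNl.
  apply/(le_lambda_min _ s_gt0 Asym) => u.
  by rewrite mulNr lerNl (le_trans _ (A_abs u)) // -normrN ler_norm.
have eU : eta0 <= c2 * Ug `^ gamma.
  rewrite /eta0 ler_wpM2l ?(ltW c2_gt0) //.
  by apply: ge0_ler_powR; rewrite ?nnegrE ?(ltW Ug_gt0) ?enorm_ge0.
move=> z0 /(le_trans (ler_norm _)) Az.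
have : c1 * Lambda f P x * dot z z <= c1 * (nu * UH) * dot z z.
  by rewrite ler_wpM2r // ler_wpM2l // ltW // (lt_trans ltr01).
have : eta0 * dot z z <= c2 * Ug `^ gamma * dot z z by rewrite ler_wpM2r.
rewrite /B; lra.
Qed.

Let B_gt0 : 0 < B.
Proof.
have c0 : 0 < c1 by rewrite (lt_trans ltr01).
apply: addr_gt0; last by rewrite mulr_gt0 // powR_gt0.
by apply: mulr_gt0 => //; apply: mulr_gt0 => //; exact: addr_gt0.
Qed.

(** Minimality of l > 0 means that beta^(l - 1) is too long for [armijo_short],
    so beta^l >= tmin. The decrease granted by Armijo's rule is
    alpha beta^l (y . M y), and M y = P g with M <= B gives
    y . M y >= |P g|^2 / B. *)
Lemma step_decrease l : least_armijo f alpha beta x dd l ->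
  2 * pconst n s gamma c1 c2 alpha beta Cbar Ug UH LH * enorm (P *m g) ^+ 2 <=
  f x - f (x + beta ^+ l *: dd).
Proof.
move=> [armi lmin].
pose K := nu ^+ 2 * LH * Ug `^ (1 - 2 * gamma).
have K0 : 0 < K.
  by apply: mulr_gt0; [apply: mulr_gt0 => //; exact: exprn_gt0|exact: powR_gt0].
have tminE : tmin n s gamma c2 beta Cbar Ug LH = Num.min 1 (beta * (c2 ^+ 2 / K)).
  rewrite /tmin; congr Num.min; rewrite /K /nu.
  have U0 : Ug `^ (1 - 2 * gamma) != 0 by rewrite gt_eqF ?powR_gt0.
  move: (Ug `^ _) U0 => U U0; field.
  by rewrite U0 (gt_eqF Cbar_gt0) (gt_eqF LH_gt0) (gt_eqF n_gt0) (gt_eqF sR_gt0).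
have t_ge : tmin n s gamma c2 beta Cbar Ug LH <= beta ^+ l.
  rewrite tminE; case: l armi lmin => [_ _|l _ lmin].
    by rewrite expr0 ge_min lexx.
  rewrite ge_min exprS; apply/orP; right; rewrite ler_pM2l //.
  rewrite leNgt; apply/negP => lt.
  have := lmin l; rewrite ltnn => H; suff : false by []. apply: H.
  rewrite /armijo; apply: armijo_short;
    rewrite ?exprn_gt0 ?exprn_ile1 ?(ltW beta_gt0) ?(ltW beta_lt1) //.
  by rewrite -/K -ler_pdivlMr // ltW.
have pE : 2 * pconst n s gamma c1 c2 alpha beta Cbar Ug UH LH =
    alpha * tmin n s gamma c2 beta Cbar Ug LH / B.
  rewrite /pconst -/nu.
  have -> : 2 * Cbar * (1 + c1) * (n%:R / s%:R) * UH + 2 * c2 * Ug `^ gamma = 2 * B.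
    by rewrite /B /nu; ring.
  by field; rewrite (gt_eqF B_gt0).
have aP : enorm (P *m g) ^+ 2 <= B * a by rewrite -My; exact: psd_image_le.
have a0 : 0 <= a by exact: Mpsd.
have tm0 : 0 <= tmin n s gamma c2 beta Cbar Ug LH.
  rewrite tminE le_min ler01 /= mulr_ge0 ?(ltW beta_gt0) //.
  by rewrite divr_ge0 ?sqr_ge0 ?(ltW K0).
apply: le_trans armi; rewrite -/g -/dd gdE mulrN opprK -/a pE.
rewrite mulrAC ler_pdivrMr //.
apply: (@le_trans _ _ (alpha * tmin n s gamma c2 beta Cbar Ug LH * (B * a))).
  by rewrite ler_wpM2l // mulr_ge0 // ltW.
rewrite mulrCA [leRHS]mulrC ler_wpM2l ?(ltW B_gt0) // ler_wpM2r //.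
by rewrite ler_wpM2l // ltW.
Qed.

End Direction.
End Step.

(** * Independence and decoupling *)

Section Decoupling.
Context {d : measure_display} {T : measurableType d} {R : realType}.
Context {Pr : probability T R} {I : eqType} (X : I -> {RV Pr >-> R}).

(** The pi-system on which mutual independence is a product formula. *)
Definition cylinders (J : set I) : set (set T) :=
  [set A | exists L : seq I, exists B : I -> set R,
    [/\ uniq L, [set` L] `<=` J, forall i, measurable (B i)
      & A = \bigcap_(i in [set` L]) (X i @^-1` B i)]].

(** The sigma-algebra generated by the X i with i in J, placed on a copy of T so
    that being measurable with respect to it is ordinary measurability of a
    function on [info J]. *)
Definition info (J : set I) : measurableType (sigma_display (cylinders J)) :=
  g_sigma_algebraType (cylinders J).

Lemma cylinders_measurable J : cylinders J `<=` measurable.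
Proof.
move=> _ [L [B [_ _ mB ->]]].
apply: fin_bigcap_measurable => [|i _]; first exact: finite_seq.
by rewrite -[X in measurable X]setTI; apply: measurable_funPT.
Qed.

Lemma cylindersI J : setI_closed (cylinders J).
Proof.
move=> _ _ [L1 [B1 [u1 s1 m1 ->]]] [L2 [B2 [u2 s2 m2 ->]]].
pose C (L : seq I) (B : I -> set R) i := if i \in L then B i else setT.
exists (undup (L1 ++ L2)), (fun i => C L1 B1 i `&` C L2 B2 i); split.
- exact: undup_uniq.
- by move=> i /=; rewrite mem_undup mem_cat => /orP[/s1|/s2].
- by move=> i; apply: measurableI; rewrite /C; case: ifP.
apply/seteqP; split=> w /=.
  move=> [h1 h2] i /=; rewrite mem_undup mem_cat /C => _.
  by split; case: ifP => // h; [apply: h1|apply: h2].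
move=> h; split=> i /= hi.
  by have := h i; rewrite /= mem_undup mem_cat hi /C hi => /(_ isT)[].
by have := h i; rewrite /= mem_undup mem_cat hi orbT /C hi => /(_ isT)[].
Qed.

Lemma cylindersT J : cylinders J setT.
Proof.
exists [::], (fun=> setT); split => //.
by apply/seteqP; split => // w _ i.
Qed.

Lemma info_measurable J : <<s cylinders J>> `<=` @measurable _ T.
Proof.
apply: smallest_sub; last exact: cylinders_measurable.
exact: sigma_algebra_measurable.
Qed.

Lemma measurable_to_info J : measurable_fun setT (id : T -> info J).
Proof. by move=> _ A mA; rewrite setTI; exact: info_measurable mA. Qed.

Definition to_info J : {mfun T >-> info J} :=
  HB.pack (id : T -> info J)
    (isMeasurableFun.Build _ _ _ _ _ (@measurable_to_info J)).

Definition info_prob J : probability (info J) R :=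
  distribution Pr (to_info J).

Hypothesis X_indep : mutually_independent X.

Lemma cylinders_indep J K A B : J `&` K = set0 ->
  cylinders J A -> cylinders K B -> Pr (A `&` B) = (Pr A * Pr B)%E.
Proof.
move=> JK [L1 [B1 [u1 s1 m1 ->]]] [L2 [B2 [u2 s2 m2 ->]]].
have L12 i : i \in L1 -> i \in L2 -> False.
  by move=> /s1 h1 /s2 h2; have : (J `&` K) i by []; rewrite JK.
pose B0 i := if i \in L1 then B1 i else B2 i.
have -> : \bigcap_(i in [set` L1]) (X i @^-1` B1 i) `&`
    \bigcap_(i in [set` L2]) (X i @^-1` B2 i) =
    \bigcap_(i in [set` L1 ++ L2]) (X i @^-1` B0 i).
  apply/seteqP; split=> w /=.
    move=> [h1 h2] i /=; rewrite mem_cat /B0 => /orP[hi|hi].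
      by rewrite hi; exact: h1.
    by case: ifP => [/L12/(_ hi)//|_]; exact: h2.
  move=> h; split=> i /= hi; have := h i; rewrite /= mem_cat hi ?orbT /B0.
    by rewrite hi => /(_ isT).
  by case: ifP => [/L12/(_ hi)//|_]; exact.
rewrite !X_indep //; first last.
- by move=> i; rewrite /B0; case: ifP.
- rewrite cat_uniq u1 u2 andbT /=; apply/hasPn => i i2.
  by apply/negP => i1; exact: L12 i1 i2.
rewrite big_cat /=; congr (_ * _)%E; rewrite !big_seq; apply: eq_bigr => i hi.
  by rewrite /B0 hi.
by rewrite /B0; case: ifP => // /L12/(_ hi).
Qed.

(** For fixed B both sides are finite measures in A, so equality extends from
    the cylinders to the sigma-algebra that they generate; then the same is done
    in B. *)
Lemma info_indep J K A B : J `&` K = set0 ->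
  <<s cylinders J>> A -> <<s cylinders K>> B ->
  Pr (A `&` B) = (Pr A * Pr B)%E.
Proof.
move=> JK sA sB.
have Pfin C : measurable C -> (Pr C < +oo)%E.
  by move=> mC; apply: le_lt_trans (ltry 1); exact: probability_le1.
have step J' (C : set T) (mC : measurable C) :
    (forall A, cylinders J' A -> Pr (A `&` C) = (Pr A * Pr C)%E) ->
  forall A, <<s cylinders J'>> A -> Pr (A `&` C) = (Pr A * Pr C)%E.
  move=> H A' sA'.
  have r0 : 0 <= fine (Pr C) by exact: fine_ge0.
  have scaleE D : mscale (NngNum r0) Pr D = (Pr D * Pr C)%E.
    by rewrite /mscale /= fineK ?fin_num_measure// muleC.
  rewrite -scaleE -[LHS]/(mrestr Pr mC A').
  apply: (g_sigma_algebra_measure_unique (cylinders J') _ (fun=> setT)) => //.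
  - exact: cylinders_measurable.
  - by move=> _; exact: cylindersT.
  - exact: bigcup_const.
  - exact: cylindersI.
  - by move=> D /H DE; rewrite [RHS]scaleE.
  - by move=> k; rewrite [ltLHS]/(mrestr _ _ _) setTI; exact: Pfin.
apply: (step J) => //; first exact: info_measurable sB.
move=> D cD; rewrite setIC muleC; move: (B) sB; apply: step => //.
  exact: cylinders_measurable cD.
by move=> E cE; rewrite setIC muleC; exact: cylinders_indep JK cD cE.
Qed.

Lemma measurable_diagonal J K :
  measurable_fun setT (fun w : T => (w, w) : info J * info K).
Proof.
by apply: measurable_fun_pair; exact: measurable_to_info.
Qed.

Definition diagonal J K : {mfun T >-> (info J * info K)%type} :=
  HB.pack (fun w : T => (w, w) : info J * info K)
    (isMeasurableFun.Build _ _ _ _ _ (@measurable_diagonal J K)).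

(** The joint law of two independent pieces of information is a product, so
    the second occurrence of the outcome may be replaced by an independent
    copy of it. *)
Lemma decoupling J K (F : (info J * info K)%type -> \bar R) : J `&` K = set0 ->
  measurable_fun setT F ->
  (forall z, (0 <= F z)%E) ->
  (\int[Pr]_w F (w, w) = \int[Pr]_w \int[Pr]_v F (w, v))%E.
Proof.
move=> JK mF F0.
transitivity (\int[distribution Pr (diagonal J K)]_z F z)%E.
  by rewrite ge0_integral_distribution.
transitivity (\int[info_prob J \x info_prob K]_z F z)%E.
  apply: eq_measure_integral => A mA _ /=; apply/esym.
  apply: product_measure_unique => // B C mB mC.
  by rewrite /distribution /pushforward /= -(info_indep JK mB mC).
rewrite fubini_tonelli1 // /fubini_F.
have mG := measurable_fun_fubini_tonelli_F F mF F0.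
rewrite ge0_integral_distribution; [|exact: mG|]; last first.
  by move=> w; apply: integral_ge0.
apply: eq_integral => w _ /=.
by rewrite ge0_integral_distribution //; exact: measurableT_comp.
Qed.

Lemma measurable_info_sub J K : J `<=` K ->
  measurable_fun setT (id : info K -> info J).
Proof.
move=> JK _ A mA; rewrite setTI; move: A mA; apply: smallest_sub.
  exact: sigma_algebra_measurable.
move=> _ [L [B [u s m ->]]]; apply: sub_sigma_algebra.
by exists L, B; split => //; exact: subset_trans JK.
Qed.

Lemma measurable_info_X J i : J i -> measurable_fun setT (X i : info J -> R).
Proof.
move=> Ji _ B mB; rewrite setTI; apply: sub_sigma_algebra.
exists [:: i], (fun=> B); split => //.
  by move=> k /=; rewrite inE => /eqP ->.
apply/seteqP; split=> w /=; first by move=> h k /=; rewrite inE => /eqP ->.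
by move=> /(_ i); rewrite /= inE eqxx => /(_ isT).
Qed.

Lemma measurable_partial_integral J K (F : (info J * info K)%type -> \bar R) :
  measurable_fun setT F -> (forall z, (0 <= F z)%E) ->
  measurable_fun setT (fun w : T => \int[Pr]_v F (w, v))%E.
Proof.
move=> mF F0.
have mG := measurable_fun_fubini_tonelli_F (m2 := info_prob K) F mF F0.
have -> : (fun w : T => \int[Pr]_v F (w, v))%E = fubini_F (info_prob K) F.
  apply/funext => w; rewrite /fubini_F ge0_integral_distribution //.
  exact: measurableT_comp.
exact: (measurableT_comp mG (@measurable_to_info J)).
Qed.

Lemma measurable_info_mono J K d' (S : measurableType d') (g : T -> S) :
  J `<=` K -> measurable_fun setT (g : info J -> S) ->
  measurable_fun setT (g : info K -> S).
Proof.
move=> JK mg.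
exact: (measurableT_comp mg (measurable_info_sub JK)).
Qed.

Lemma measurable_from_info J d' (S : measurableType d') (g : T -> S) :
  measurable_fun setT (g : info J -> S) -> measurable_fun setT g.
Proof. by move=> mg; exact: (measurableT_comp mg (@measurable_to_info J)). Qed.

Lemma indep_integralM J K (g h : T -> R) : J `&` K = set0 ->
  measurable_fun setT (g : info J -> R) -> measurable_fun setT (h : info K -> R) ->
  (forall w, 0 <= g w) -> (forall w, 0 <= h w) ->
  (\int[Pr]_w (g w * h w)%:E = \int[Pr]_w (g w)%:E * \int[Pr]_w (h w)%:E)%E.
Proof.
move=> JK mg mh g0 h0.
pose F (z : (info J * info K)%type) := (g z.1 * h z.2)%:E.
rewrite (@decoupling J K F) //; first last.
- by move=> z; rewrite lee_fin mulr_ge0.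
- apply/measurable_EFinP; apply: measurable_funM.
    exact: (measurableT_comp mg).
  exact: (measurableT_comp mh).
rewrite -ge0_integralZr //=; first last.
- by apply: integral_ge0 => w _; rewrite lee_fin.
- by move=> w _; rewrite lee_fin.
- by apply/measurable_EFinP; exact: measurable_from_info mg.
apply: eq_integral => w _.
under eq_integral do rewrite /F /= EFinM.
rewrite ge0_integralZl //=.
- by apply/measurable_EFinP; exact: measurable_from_info mh.
- by move=> v _; rewrite lee_fin.
- by rewrite lee_fin.
Qed.

Lemma indep_integral_prod (A : eqType) (L : seq A) (J : A -> set I)
    (g : A -> T -> R) : uniq L ->
  (forall a b, a != b -> J a `&` J b = set0) ->
  (forall a, measurable_fun setT (g a : info (J a) -> R)) ->
  (forall a w, 0 <= g a w) ->
  (\int[Pr]_w (\prod_(a <- L) g a w)%:E = \prod_(a <- L) \int[Pr]_w (g a w)%:E)%E.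
Proof.
move=> uL dJ mg g0; elim: L uL => [_|a L ih /= /andP[aL uL]].
  under eq_integral do rewrite big_nil.
  by rewrite big_nil integral_cst // mul1e; exact: probability_setT.
under eq_integral do rewrite big_cons.
rewrite big_cons -ih // (@indep_integralM (J a) (\bigcup_(b in [set` L]) J b)
  (g a) (fun w => \prod_(b <- L) g b w)) //.
- apply/seteqP; split => // i [Jai [b /= bL Jbi]].
  have ab : a != b by apply: contraNneq aL => ->.
  by have : (J a `&` J b) i by []; rewrite dJ.
- apply: measurable_prod => b bL.
  by apply: measurable_info_mono (mg b) => i Jbi; exists b.
- by move=> w; exact: prodr_ge0.
Qed.

End Decoupling.

(** * Gaussian integrals *)

Section IntegralDensity.
Import HBNNSimple.

(** True of indicators by definition, hence of simple functions by linearity and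
    of nonnegative measurable functions by monotone convergence. *)
Lemma ge0_integral_density d (T : measurableType d) (R : realType)
    (mu nu : {measure set T -> \bar R}) (p : T -> R) (f : T -> \bar R) :
  measurable_fun setT p -> (forall x, 0 <= p x) ->
  (forall A, measurable A -> nu A = \int[mu]_(x in A) (p x)%:E)%E ->
  measurable_fun setT f -> (forall x, (0 <= f x)%E) ->
  (\int[nu]_x f x = \int[mu]_x (f x * (p x)%:E))%E.
Proof.
move=> mp p0 nuE mf f0.
pose f_ := nnsfun_approx measurableT mf.
transitivity (limn (fun n => \int[nu]_x (f_ n x)%:E)%E).
  rewrite -monotone_convergence//=.
  - apply: eq_integral => ? /[!inE] xD; apply/esym/cvg_lim => //=.
    exact: cvg_nnsfun_approx.
  - by move=> n; exact/measurable_EFinP/measurable_funTS.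
  - by move=> n ? _; rewrite lee_fin.
  - by move=> ? _ ? ? mn; rewrite lee_fin; exact/lefP/nd_nnsfun_approx.
transitivity (limn (fun n => \int[mu]_x ((f_ n x)%:E * (p x)%:E))%E); last first.
  rewrite -monotone_convergence//=.
  - apply: eq_integral => x /[!inE] xD; apply: cvg_lim => //=.
    rewrite muleC.
    under eq_fun do rewrite muleC.
    by apply: cvgeZl => //; exact: cvg_nnsfun_approx.
  - move=> n; apply/measurable_EFinP/measurable_funM => //.
  - by move=> n ? _; rewrite -EFinM lee_fin mulr_ge0.
  - move=> x _ a b ab; rewrite -!EFinM lee_fin ler_wpM2r //.
    exact/lefP/nd_nnsfun_approx.
apply: congr_lim; apply/funext => n.
have pE : measurable_fun setT (EFin \o p) by exact/measurable_EFinP.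
transitivity (\sum_(k \in range (f_ n))
    \int[nu]_x (k * \1_(f_ n @^-1` [set k]) x)%:E)%E.
  under eq_integral do rewrite fimfunE -fsumEFin//.
  rewrite ge0_integral_fsum//.
  - by move=> y; exact/measurable_EFinP/measurable_funM.
  - by move=> y x _; rewrite EFinM nnfun_muleindic_ge0.
under [RHS]eq_integral => x _.
  rewrite fimfunE -fsumEFin// ge0_mule_fsuml; last first.
    by move=> y; rewrite EFinM nnfun_muleindic_ge0.
  over.
rewrite ge0_integral_fsum//; last 2 first.
- move=> r; apply: emeasurable_funM => //.
  exact/measurable_EFinP/measurable_funM.
- by move=> r x _; rewrite mule_ge0 ?lee_fin// -lee_fin EFinM nnfun_muleindic_ge0.
apply: eq_fsbigr => r /[!inE] -[t _ rt].
have r0 : 0 <= r by rewrite -rt.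
rewrite integralZl_indic_nnsfun// integral_indic//= setIT.
rewrite nuE //.
under [RHS]eq_integral do rewrite EFinM -muleA.
rewrite ge0_integralZl//; last 2 first.
- by apply: emeasurable_funM => //; apply/measurable_EFinP.
- by move=> x _; rewrite mule_ge0// lee_fin.
congr (_ * _)%E; rewrite integral_mkcond; apply: eq_integral => x _.
rewrite patchE indicE; case: ifP => _; first by rewrite mul1e.
by rewrite mul0e.
Qed.

End IntegralDensity.

Lemma complete_square (F : fieldType) (lam tau c y : F) :
  tau != 0 -> 1 + 2 * lam * tau ^+ 2 != 0 -> (2 : F) != 0 ->
  let q := 1 + 2 * lam * tau ^+ 2 in
  - (lam * (c + y) ^+ 2) + - (y - 0) ^+ 2 / (tau ^+ 2 *+ 2) =
  - (lam / q * c ^+ 2) +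
  - (y - - (2 * lam * tau ^+ 2 * c / q)) ^+ 2 / (tau ^+ 2 / q *+ 2).
Proof.
move=> tau0 q0 n20 /=; rewrite -[tau ^+ 2 *+ 2]mulr_natr -[_ / _ *+ 2]mulr_natr; field.
by rewrite tau0 q0 n20.
Qed.

(** Completing the square turns a Gaussian factor times a centred normal
    density into a multiple of another normal density, whose mass is 1. *)
Lemma integral_normal_gauss (R : realType) (tau lam c : R) : 0 < tau ->
  0 < 1 + 2 * lam * tau ^+ 2 ->
  (\int[normal_prob 0 tau]_y (expR (- (lam * (c + y) ^+ 2)))%:E =
   ((Num.sqrt (1 + 2 * lam * tau ^+ 2))^-1 *
    expR (- (lam / (1 + 2 * lam * tau ^+ 2) * c ^+ 2)))%:E)%E.
Proof.
move=> tau0 q0; move: q0; set q := 1 + _; have qE : q = 1 + 2 * lam * tau ^+ 2 by [].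
move: q qE => q qE q0.
have mexp : measurable_fun setT (fun y : R => expR (- (lam * (c + y) ^+ 2))).
  apply: measurableT_comp => //; apply: measurable_funN.
  by apply: measurable_funM => //; apply: measurable_funX; apply: measurable_funD.
rewrite (@ge0_integral_density _ _ _ lebesgue_measure _ (normal_pdf 0 tau)) //=.
- have sq0 : 0 < Num.sqrt q by rewrite sqrtr_gt0.
  pose tau' := tau / Num.sqrt q; pose m := - (2 * lam * tau ^+ 2 * c / q).
  have tau'0 : 0 < tau' by rewrite divr_gt0.
  pose K := (Num.sqrt q)^-1 * expR (- (lam / q * c ^+ 2)).
  transitivity (\int[lebesgue_measure]_y (K%:E * (normal_pdf m tau' y)%:E))%E;
      last first.
    rewrite ge0_integralZl //=.
    + by rewrite integral_normal_pdf mule1.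
    + by apply/measurable_EFinP; exact: measurable_normal_pdf.
    + by move=> y _; rewrite lee_fin normal_pdf_ge0.
    + by rewrite lee_fin mulr_ge0 ?expR_ge0// invr_ge0 sqrtr_ge0.
  apply: eq_integral => y _; rewrite -!EFinM; congr EFin.
  rewrite !normal_pdfE ?gt_eqF// /normal_peak /normal_fun /K.
  have tauE : tau' ^+ 2 = tau ^+ 2 / q.
    by rewrite expr_div_n sqr_sqrtr // ltW.
  have -> : Num.sqrt (tau' ^+ 2 * pi *+ 2) =
      Num.sqrt (tau ^+ 2 * pi *+ 2) / Num.sqrt q.
    rewrite tauE -sqrtrV ?ltW// -sqrtrM; last first.
      by rewrite mulrn_wge0 // mulr_ge0 ?sqr_ge0 ?pi_ge0.
    by rewrite mulrnAl mulrAC.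
  have s20 : 0 < Num.sqrt (tau ^+ 2 * pi *+ 2).
    by rewrite sqrtr_gt0 mulrn_wgt0 // mulr_gt0 ?pi_gt0 // exprn_gt0.
  have expE : expR (- (lam * (c + y) ^+ 2)) *
      expR (- (y - 0) ^+ 2 / (tau ^+ 2 *+ 2)) =
      expR (- (lam / q * c ^+ 2)) * expR (- (y - m) ^+ 2 / (tau' ^+ 2 *+ 2)).
    rewrite -!expRD tauE /m qE; congr expR; apply: complete_square.
    - by rewrite gt_eqF.
    - by rewrite -qE gt_eqF.
    - by rewrite pnatr_eq0.
  rewrite [LHS]mulrCA expE; move: (expR _) (expR _) => e3 e4.
  move: (Num.sqrt (_ *+ 2)) (Num.sqrt q) s20 sq0 => S r S0 r0.
  by field; rewrite !gt_eqF.
- exact: measurable_normal_pdf.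
- by move=> x; exact: normal_pdf_ge0.
- exact/measurable_EFinP.
Qed.

(** Integrating out summands of total weight S replaces lam by lam / q; this
    identity combines two successive such replacements. *)
Lemma laplace_denomD (F : fieldType) (lam tau2 u2 S : F) :
  let q := 1 + 2 * lam * tau2 * S in q != 0 ->
  1 + 2 * lam * tau2 * (u2 + S) = q * (1 + 2 * (lam / q) * tau2 * u2).
Proof.
move=> q q0; transitivity (q + 2 * lam * tau2 * u2); first by rewrite /q; ring.
by move: (q) q0 => r r0; field.
Qed.

Lemma laplace_denom_gt0 (R : realDomainType) (lam tau S : R) :
  0 <= lam -> 0 <= S -> 0 < 1 + 2 * lam * tau ^+ 2 * S.
Proof.
by move=> lam0 S0; rewrite ltr_wpDr // mulr_ge0 // mulr_ge0 ?sqr_ge0 // mulr_ge0.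
Qed.

Lemma integral_normal_gaussZ (R : realType) (tau lam c u : R) : 0 < tau -> 0 <= lam ->
  (\int[normal_prob 0 tau]_y (expR (- (lam * (c + u * y) ^+ 2)))%:E =
   ((Num.sqrt (1 + 2 * lam * tau ^+ 2 * u ^+ 2))^-1 *
    expR (- (lam / (1 + 2 * lam * tau ^+ 2 * u ^+ 2) * c ^+ 2)))%:E)%E.
Proof.
move=> tau0 lam0; have [->|u0] := eqVneq u 0.
  under eq_integral do rewrite mul0r addr0.
  by rewrite integral_cst //= probability_setT mule1 expr0n mulr0 addr0 sqrtr1 invr1
    mul1r mulr1.
have u20 : 0 < u ^+ 2 by rewrite exprn_even_gt0.
under eq_integral => y _.
  rewrite (_ : lam * (c + u * y) ^+ 2 = (lam * u ^+ 2) * (c / u + y) ^+ 2); last first.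
    by field.
  over.
have qE : 1 + 2 * (lam * u ^+ 2) * tau ^+ 2 = 1 + 2 * lam * tau ^+ 2 * u ^+ 2 by ring.
have q0 : 0 < 1 + 2 * lam * tau ^+ 2 * u ^+ 2.
  by rewrite laplace_denom_gt0 // ?sqr_ge0.
rewrite integral_normal_gauss ?qE//; congr (_ * expR (- _))%:E.
by field; rewrite u0 gt_eqF.
Qed.

Section GaussianLaplace.
Context {d : measure_display} {T : measurableType d} {R : realType}.
Context {Pr : probability T R} {I : eqType} {X : I -> {RV Pr >-> R}} {tau : R}.
Hypotheses (X_iid : iid_normal X tau) (tau0 : 0 < tau).

Lemma iid_normal_integral i (h : R -> R) :
  measurable_fun setT h -> (forall y, 0 <= h y) ->
  (\int[Pr]_w (h (X i w))%:E = \int[normal_prob 0 tau]_y (h y)%:E)%E.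
Proof.
move=> mh h0.
have mX : @measurable_fun _ _ T (measurableTypeR R) setT (X i).
  by move=> ? B mB; exact: (measurable_funPT (X i)).
have mh' : @measurable_fun _ _ (measurableTypeR R) _ setT (EFin \o h).
  exact: (measurable_EFinP _ _).2.
transitivity (\int[pushforward Pr (X i : T -> measurableTypeR R)]_y (h y)%:E)%E.
  rewrite (ge0_integral_pushforward mX Pr measurableT mh') //.
  by move=> y _; rewrite /= lee_fin.
apply: eq_measure_integral => A mA _; exact: X_iid.1.
Qed.

(** A linear combination of independent centred normal variables has the
    Laplace transform of a normal variable; the shift c makes the induction on
    the number of summands go through. *)
Lemma laplace_linear (L : seq I) (u : I -> R) (lam c : R) : uniq L -> 0 <= lam ->
  let q := 1 + 2 * lam * tau ^+ 2 * \sum_(i <- L) u i ^+ 2 in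
  (\int[Pr]_w (expR (- (lam * (c + \sum_(i <- L) u i * X i w) ^+ 2)))%:E =
   ((Num.sqrt q)^-1 * expR (- (lam / q * c ^+ 2)))%:E)%E.
Proof.
move=> + lam0; elim: L c => [c _|i L ih c /= /andP[iL uL]] /=.
  under eq_integral do rewrite big_nil addr0.
  rewrite big_nil mulr0 addr0 sqrtr1 invr1 mul1r mulr1.
  rewrite integral_cst // -[RHS]mule1; congr (_ * _)%E; exact: probability_setT.
under eq_integral do rewrite big_cons addrA.
set S := \sum_(i <- L) u i ^+ 2.
have S0 : 0 <= S by apply: sumr_ge0 => k _; exact: sqr_ge0.
set q := 1 + 2 * lam * tau ^+ 2 * S.
have q0 : 0 < q by rewrite laplace_denom_gt0 // ?sqr_ge0.
pose F (z : (info X [set i] * info X [set` L])%type) :=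
  (expR (- (lam * (c + u i * X i z.1 + \sum_(j <- L) u j * X j z.2) ^+ 2)))%:E.
rewrite (@decoupling _ _ _ _ _ _ X_iid.2 _ _ F); first last.
- by move=> z; rewrite lee_fin expR_ge0.
- apply/measurable_EFinP; apply: measurableT_comp => //; apply: measurable_funN.
  apply: measurable_funM => //; apply: measurable_funX; apply: measurable_funD.
    apply: measurable_funD => //; apply: measurable_funM => //.
    have mXi : measurable_fun setT (X i : info X [set i] -> R).
      exact: measurable_info_X.
    exact: (measurableT_comp mXi measurable_fst).
  have sumE : (fun z : (info X [set i] * info X [set` L])%type =>
      \sum_(j <- L) u j * X j z.2) =
      (fun z => \sum_(j <- L) (if j \in L then u j * X j z.2 else 0)).
    by apply/funext => z; rewrite big_seq [RHS]big_seq; apply: eq_bigr => j ->.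
  rewrite sumE; apply: measurable_sum => j.
  have [jL|_] := boolP (j \in L); last exact: measurable_cst.
  apply: measurable_funM => //.
  have mXj : measurable_fun setT (X j : info X [set` L] -> R).
    exact: measurable_info_X.
  exact: (measurableT_comp mXj measurable_snd).
- by apply/seteqP; split => // j [/= ->]; rewrite /= (negbTE iL).
rewrite /F /=; under eq_integral do rewrite ih //.
rewrite (@iid_normal_integral i (fun y => (Num.sqrt q)^-1 *
   expR (- (lam / q * (c + u i * y) ^+ 2)))) //; last first.
- apply: measurable_funM => //; apply: measurableT_comp => //; apply: measurable_funN.
  apply: measurable_funM => //; apply: measurable_funX; apply: measurable_funD => //.
under eq_integral do rewrite EFinM.
rewrite ge0_integralZl //=; last first.
- apply/measurable_EFinP; apply: measurableT_comp => //; apply: measurable_funN.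
  apply: measurable_funM => //; apply: measurable_funX; apply: measurable_funD => //.
rewrite integral_normal_gaussZ // ?divr_ge0 ?(ltW q0)// -EFinM; congr EFin.
rewrite big_cons.
set q' := 1 + 2 * (lam / q) * tau ^+ 2 * u i ^+ 2.
have q'0 : 0 < q' by rewrite laplace_denom_gt0 ?sqr_ge0 // divr_ge0 // ltW.
have -> : 1 + 2 * lam * tau ^+ 2 * (u i ^+ 2 + S) = q * q'.
  by apply: laplace_denomD; rewrite gt_eqF.
clearbody q'; clear F; clearbody q; rewrite sqrtrM ?(ltW q0) //.
by rewrite !invfM !mulrA.
Qed.

End GaussianLaplace.

Lemma iid_normal_reindex d (T : measurableType d) (R : realType)
    (Pr : probability T R) (I A : eqType) (X : I -> {RV Pr >-> R}) (tau : R)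
    (h : A -> I) : injective h ->
  iid_normal X tau -> iid_normal (fun a => X (h a)) tau.
Proof.
move=> hinj [Xn Xi]; split=> [a B mB|L B uL mB]; first exact: Xn.
(* In place of an inverse of h: by injectivity at most one B a occurs in the
   intersection. *)
pose B' i : set R := \bigcap_(a in [set a | a \in L /\ h a = i]) B a.
have mB' i : measurable (B' i).
  rewrite /B' (_ : mkset _ = [set` [seq a <- L | h a == i]]).
    by apply: fin_bigcap_measurable => //; exact: finite_seq.
  apply/seteqP; split=> a /=; rewrite mem_filter.
    by move=> [aL /eqP ->].
  by move=> /andP[/eqP ? ?].
have BE a : a \in L -> B' (h a) = B a.
  move=> aL; apply/seteqP; split=> y /=; first by apply.
  by move=> By b [_ /hinj ->].
have := Xi (map h L) B'; rewrite map_inj_uniq // => /(_ uL mB').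
rewrite big_map [X in _ = X -> _]big_seq => E.
rewrite [RHS]big_seq; rewrite [RHS](eq_bigr (fun a => Pr (X (h a) @^-1` B' (h a)))).
  rewrite -E; congr (Pr _); apply/seteqP; split=> w /= H.
    by move=> _ /= /mapP[a aL ->] b [bL /hinj ba]; rewrite -ba; exact: H.
  by move=> a /= aL; have := H (h a); rewrite /= map_f // BE // => /(_ isT).
by move=> a aL; rewrite BE.
Qed.

Section GaussianMatrixLaplace.
Context {d : measure_display} {T : measurableType d} {R : realType}.
Context {Pr : probability T R} {s n : nat}.
Context {X : 'I_s * 'I_n -> {RV Pr >-> R}} {tau : R}.
Hypotheses (X_iid : iid_normal X tau) (tau0 : 0 < tau).

Definition rowset (i : 'I_s) : set ('I_s * 'I_n) := [set ij | ij.1 = i].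

Lemma measurable_row (u : 'I_n -> R) i :
  measurable_fun setT ((fun w => \sum_j u j * X (i, j) w) : info X (rowset i) -> R).
Proof.
apply: measurable_sum => j; apply: measurable_funM => //.
exact: measurable_info_X.
Qed.

(** The rows of a Gaussian matrix applied to a fixed vector are independent,
    so the Laplace transform of the squared norm is a power. *)
Lemma laplace_matrix (u : 'I_n -> R) (lam : R) : 0 <= lam ->
  (\int[Pr]_w (expR (- (lam * \sum_i (\sum_j u j * X (i, j) w) ^+ 2)))%:E =
   ((Num.sqrt (1 + 2 * lam * tau ^+ 2 * \sum_j u j ^+ 2))^-1 ^+ s)%:E)%E.
Proof.
move=> lam0.
pose g (i : 'I_s) w := expR (- (lam * (0 + \sum_j u j * X (i, j) w) ^+ 2)).
transitivity (\int[Pr]_w (\prod_(i <- index_enum 'I_s) g i w)%:E)%E.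
  apply: eq_integral => w _; congr EFin; rewrite mulr_sumr -sumrN expR_sum.
  by apply: eq_bigr => i _; rewrite /g add0r.
rewrite (@indep_integral_prod _ _ _ _ _ X X_iid.2 _ _ rowset) //.
- transitivity (\prod_(i < s)
    ((Num.sqrt (1 + 2 * lam * tau ^+ 2 * \sum_j u j ^+ 2))^-1)%:E)%E.
    apply: eq_bigr => i _; rewrite /g.
    have inj : injective (pair i : 'I_n -> 'I_s * 'I_n) by move=> a b [].
    rewrite (laplace_linear (iid_normal_reindex inj X_iid)) ?index_enum_uniq //.
    by rewrite expr0n mulr0 oppr0 expR0 mulr1.
  by rewrite prodEFin prodr_const card_ord.
- exact: index_enum_uniq.
- move=> a b ab; apply/seteqP; split => // ij [/= ia ib].
  by move: ab; rewrite -ia -ib eqxx.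
- move=> i; apply: measurableT_comp => //; apply: measurable_funN.
  apply: measurable_funM => //; apply: measurable_funX.
  under eq_fun do rewrite add0r.
  exact: measurable_row.
- by move=> i w; exact: expR_ge0.
Qed.

End GaussianMatrixLaplace.

(** * Rescaling Gaussian families *)

Lemma measurable_dilation (R : realType) (c : R) :
  @measurable_fun _ _ (measurableTypeR R) (measurableTypeR R) setT
    (fun x : R => c * x).
Proof. by move=> ? C mC; exact: (mulrl_measurable c measurableT). Qed.

(** The image of Lebesgue measure under x |-> c * x. The measure structure is
    named explicitly because it depends on the proof that this map is
    measurable. *)
Definition dilated_lebesgue (R : realType) (c : R) :
    {measure set (measurableTypeR R) -> \bar R} :=
  measure_function_pushforward__canonical__measure_function_Measure
    lebesgue_measure (@measurable_dilation R c).

(** Both measures give the same mass to intervals. *)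
Lemma lebesgue_measure_scale (R : realType) (c : R) (c0 : 0 <= c)
    (A : set R) : 0 < c -> measurable A ->
  lebesgue_measure A = mscale (NngNum c0) (dilated_lebesgue c) A.
Proof.
move=> cp mA; apply: lebesgue_measure_unique => // _ [[a b] _ <-].
rewrite -[RHS]/(c%:E * lebesgue_measure ((fun x : R => c * x)%R @^-1` `]a, b]))%E.
have -> : (fun x : R => c * x) @^-1` `]a, b] = `]a / c, b / c]%classic :> set R.
  apply/seteqP; split=> x /=; rewrite !in_itv /=.
    by rewrite ltr_pdivrMr // ler_pdivlMr // ![x * c]mulrC.
  by rewrite ltr_pdivrMr // ler_pdivlMr // ![x * c]mulrC.
rewrite !lebesgue_measure_itv /= !lte_fin ltr_pM2r ?invr_gt0//.
case: ifPn => _; last by rewrite mule0.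
by rewrite -!EFinD -EFinM; congr EFin; field; rewrite gt_eqF.
Qed.

Lemma normal_prob_scale (R : realType) (c tau : R) (B : set R) :
  0 < c -> 0 < tau -> measurable B ->
  normal_prob 0 tau ((fun x => c * x) @^-1` B) = normal_prob 0 (c * tau) B.
Proof.
move=> c0 tau0 mB; rewrite /normal_prob.
have mc := @measurable_dilation R c.
have mpdf : @measurable_fun _ _ (measurableTypeR R) _ B
    (EFin \o normal_pdf 0 (c * tau)).
  by apply: measurable_funTS; apply/measurable_EFinP; exact: measurable_normal_pdf.
rewrite [RHS](eq_measure_integral (mscale (NngNum (ltW c0)) (dilated_lebesgue c)));
  last by move=> A mA _; exact: lebesgue_measure_scale.
rewrite ge0_integral_mscale //=; last first.
  by move=> x _; rewrite lee_fin normal_pdf_ge0.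
rewrite (ge0_integral_pushforward mc lebesgue_measure mB mpdf); last first.
  by move=> x _; rewrite /= lee_fin normal_pdf_ge0.
rewrite -ge0_integralZl //=.
- apply: eq_integral => x _ /=; rewrite -EFinM; congr EFin.
  rewrite !normal_pdfE ?gt_eqF ?mulr_gt0// /normal_peak /normal_fun !subr0.
  rewrite mulrA; congr (_ * expR _).
    have -> : (c * tau) ^+ 2 * pi *+ 2 = c ^+ 2 * (tau ^+ 2 * pi *+ 2).
      by rewrite exprMn -mulrA mulrnAr.
    rewrite sqrtrM ?sqr_ge0 // sqrtr_sqr gtr0_norm // invfM.
    by rewrite mulVKf // gt_eqF.
  rewrite -[tau ^+ 2 *+ 2]mulr_natr -[(c * tau) ^+ 2 *+ 2]mulr_natr.
  by field; rewrite !gt_eqF.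
- by rewrite -[X in measurable X]setTI; exact: mc.
- apply/measurable_EFinP; apply: measurable_funTS.
  by apply: (measurableT_comp (measurable_normal_pdf _ _)).
- by move=> x _; rewrite lee_fin normal_pdf_ge0.
- by rewrite lee_fin ltW.
Qed.

Section ScaleFamily.
Context {d : measure_display} {T : measurableType d} {R : realType}.
Context {Pr : probability T R} {I : eqType}.

Lemma measurable_scale (c : R) (X : {RV Pr >-> R}) :
  measurable_fun setT (fun w => c * X w).
Proof. exact: measurable_funM. Qed.

Definition scale_rv (c : R) (X : {RV Pr >-> R}) : {RV Pr >-> R} :=
  HB.pack (fun w => c * X w)
    (isMeasurableFun.Build _ _ _ _ _ (measurable_scale c X)).

Lemma iid_normal_scale (c tau : R) (X : I -> {RV Pr >-> R}) :
  0 < c -> 0 < tau ->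
  iid_normal X tau -> iid_normal (fun i => scale_rv c (X i)) (c * tau).
Proof.
move=> c0 tau0 [Xn Xi].
have mpre B : measurable B -> measurable ((fun x : R => c * x) @^-1` B).
  by move=> mB; rewrite -[X in measurable X]setTI; exact: mulrl_measurable.
split=> [i B mB|L B uL mB].
  by rewrite -normal_prob_scale // -(Xn i) //; exact: mpre.
have := Xi L (fun i => (fun x : R => c * x) @^-1` B i) uL.
by apply => i; exact: mpre.
Qed.

End ScaleFamily.

(** * Restrictions on the constant of the norm embedding *)

(** Unlike in [laplace_linear], lam may be negative, as long as the integral
    converges: these are the moments needed for large deviations upwards. *)
Lemma exp_moment_sumsq d (T : measurableType d) (R : realType)
    (Pr : probability T R) (A : finType) (Y : A -> {RV Pr >-> R}) (tau lam : R) :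
  iid_normal Y tau -> 0 < tau -> 0 < 1 + 2 * lam * tau ^+ 2 ->
  (\int[Pr]_w (expR (- (lam * \sum_a Y a w ^+ 2)))%:E =
   ((Num.sqrt (1 + 2 * lam * tau ^+ 2))^-1 ^+ #|A|)%:E)%E.
Proof.
move=> Yiid tau0 q0.
pose h (y : R) := expR (- (lam * (0 + y) ^+ 2)).
have mh : measurable_fun setT h.
  apply: measurableT_comp => //; apply: measurable_funN.
  by apply: measurable_funM => //; apply: measurable_funX; apply: measurable_funD.
transitivity (\int[Pr]_w (\prod_(a <- index_enum A) h (Y a w))%:E)%E.
  apply: eq_integral => w _; congr EFin; rewrite mulr_sumr -sumrN expR_sum.
  by apply: eq_bigr => i _; rewrite /h add0r.
rewrite (@indep_integral_prod _ _ _ _ _ Y Yiid.2 _ _ (fun a => [set a])) //.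
- transitivity (\prod_(a : A) ((Num.sqrt (1 + 2 * lam * tau ^+ 2))^-1)%:E)%E.
    apply: eq_bigr => a _.
    rewrite (iid_normal_integral Yiid) // => [|y]; last exact: expR_ge0.
    by rewrite integral_normal_gauss // expr0n mulr0 oppr0 expR0 mulr1.
  by rewrite prodEFin prodr_const.
- exact: index_enum_uniq.
- move=> a b ab; apply/seteqP; split => // i [/= ia ib].
  by move: ab; rewrite -ia -ib eqxx.
- move=> a; have mY : measurable_fun setT (Y a : info Y [set a] -> R).
    exact: measurable_info_X.
  exact: (measurableT_comp mh mY).
- by move=> i w; exact: expR_ge0.
Qed.

Lemma measurable_set_le d (T : measurableType d) (R : realType) (f g : T -> R) :
  measurable_fun setT f -> measurable_fun setT g ->
  measurable [set w | f w <= g w].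
Proof.
move=> mf mg; rewrite -[X in measurable X]setTI.
exact: (measurable_fun_ler mf mg measurableT (Y := [set true])).
Qed.

(** The first term suffices for a <= z <= b, the second for z < a and the third
    for b <= z. *)
Lemma exp_tilt_le (R : realType) (rho h a b r z : R) :
  0 <= rho -> 0 <= h -> 0 <= r ->
  expR (rho * r * z) <=
  expR (rho * r * b) * (a <= z)%R%:R +
  expR (h * r * a) * expR ((rho - h) * r * z) +
  expR (- (h * r * b)) * expR ((rho + h) * r * z).
Proof.
move=> rho0 h0 r0; rewrite -!expRD.
have hr0 : 0 <= h * r by rewrite mulr_ge0.
have [az|za] := leP a z; last first.
  rewrite mulr0 add0r (le_trans (y := expR (h * r * a + (rho - h) * r * z))) //.
    rewrite ler_expR -subr_ge0.
    have -> : h * r * a + (rho - h) * r * z - rho * r * z = h * r * (a - z) by ring.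
    by rewrite mulr_ge0 // subr_ge0 ltW.
  by rewrite lerDl expR_ge0.
rewrite mulr1; have [bz|zb] := leP b z.
  rewrite (le_trans (y := expR (- (h * r * b) + (rho + h) * r * z))) //.
    rewrite ler_expR -subr_ge0.
    have -> : - (h * r * b) + (rho + h) * r * z - rho * r * z = h * r * (z - b).
      by ring.
    by rewrite mulr_ge0 // subr_ge0.
  by rewrite lerDr addr_ge0 // expR_ge0.
rewrite (le_trans (y := expR (rho * r * b))) //.
  by rewrite ler_expR ler_wpM2l ?mulr_ge0 // ltW.
by rewrite -addrA lerDl addr_ge0 // expR_ge0.
Qed.

Lemma ge0_integral_scale d (T : measurableType d) (R : realType)
    (mu : {measure set T -> \bar R}) (k : R) (g : T -> R) :
  0 <= k -> measurable_fun setT g -> (forall w, 0 <= g w) ->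
  (k%:E * \int[mu]_w (g w)%:E = \int[mu]_w (k * g w)%:E)%E.
Proof.
move=> k0 mg g0; under [RHS]eq_integral do rewrite EFinM.
rewrite ge0_integralZl //=; first exact/measurable_EFinP.
by move=> w _; rewrite lee_fin.
Qed.

(** Cramer's change of measure, without the measure: if the chi-square law
    weighted by the exponential with parameter rho has its mean between a and b,
    the last two terms, which account for its mass outside of [a, b], are
    negligible, and the probability beyond a is bounded below. *)
Lemma chi2_upper_tail d (T : measurableType d) (R : realType)
    (Pr : probability T R) (r : nat) (A : finType) (Y : A -> {RV Pr >-> R})
    (rho h a b : R) : #|A| = r -> (0 < r)%N ->
  iid_normal Y (Num.sqrt r%:R)^-1 -> 0 <= rho -> 0 <= h -> rho + h < 1 / 2 ->
  ((Num.sqrt (1 - 2 * rho))^-1 ^+ r <=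
   expR (rho * r%:R * b) * fine (Pr [set w | (a <= \sum_i Y i w ^+ 2)%R]) +
   expR (h * r%:R * a) * (Num.sqrt (1 - 2 * (rho - h)))^-1 ^+ r +
   expR (- (h * r%:R * b)) * (Num.sqrt (1 - 2 * (rho + h)))^-1 ^+ r)%R.
Proof.
move=> cA r0 Yiid rho0 h0 rh.
have rR0 : 0 < r%:R :> R by rewrite ltr0n.
have tau0 : 0 < (Num.sqrt (r%:R : R))^-1 by rewrite invr_gt0 sqrtr_gt0.
have tau2 : (Num.sqrt (r%:R : R))^-1 ^+ 2 = r%:R^-1.
  by rewrite exprVn sqr_sqrtr // ltW.
pose Z w := \sum_i Y i w ^+ 2.
have mZ : measurable_fun setT Z by apply: measurable_sum => i; exact: measurable_funX.
have mexp c : measurable_fun setT (fun w => expR (c * r%:R * Z w)).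
  by apply: measurableT_comp => //; exact: measurable_funM.
have mom c : c < 1 / 2 -> (\int[Pr]_w (expR (c * r%:R * Z w))%:E =
    ((Num.sqrt (1 - 2 * c))^-1 ^+ r)%:E)%E.
  move=> c12; have qE : 1 + 2 * (- (c * r%:R)) * (Num.sqrt r%:R)^-1 ^+ 2 = 1 - 2 * c.
    by rewrite tau2; field; rewrite gt_eqF.
  rewrite -{2}cA -qE -(exp_moment_sumsq Yiid) //.
    by apply: eq_integral => w _; rewrite mulNr opprK.
  by rewrite qE; lra.
pose E := [set w | a <= Z w].
have mE : measurable E by exact: measurable_set_le.
have rho12 : rho < 1 / 2 by lra.
have rhoh12 : rho - h < 1 / 2 by lra.
have intE : Pr E = (\int[Pr]_w (\1_E w)%:E)%E by rewrite integral_indic // setIT.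
rewrite -lee_fin !EFinD !EFinM fineK ?fin_num_measure// -!mom //.
rewrite -[Pr _]/(Pr E) intE !ge0_integral_scale ?expR_ge0 //.
have mI k : measurable_fun setT (fun w => (expR k * \1_E w)%:E).
  by apply/measurable_EFinP; exact: measurable_funM.
have mX k c : measurable_fun setT (fun w => (expR k * expR (c * r%:R * Z w))%:E).
  by apply/measurable_EFinP; exact: measurable_funM.
have X0 k c w : (0 <= (expR k * expR (c * r%:R * Z w))%:E)%E.
  by rewrite lee_fin mulr_ge0 // expR_ge0.
have I0 k w : (0 <= (expR k * \1_E w)%:E)%E by rewrite lee_fin mulr_ge0 // expR_ge0.
have mIX k k' c : measurable_fun setT (fun w =>
    (expR k * \1_E w)%:E + (expR k' * expR (c * r%:R * Z w))%:E)%E.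
  exact: emeasurable_funD.
rewrite -ge0_integralD // -ge0_integralD //.
apply: ge0_le_integral => //.
- exact/measurable_EFinP.
- by apply: emeasurable_funD => //; exact: emeasurable_funD.
- move=> w _; rewrite -!EFinD lee_fin.
  rewrite (le_trans (exp_tilt_le a b (Z w) rho0 h0 (ltW rR0))) //.
  by rewrite indicE /E mem_setE.
- by move=> w _; rewrite !adde_ge0.
Qed.

Lemma geometric_sum_small (R : realType) (w0 w1 w2 : R) :
  0 <= w0 < 1 -> 0 <= w1 < 1 -> 0 <= w2 < 1 ->
  exists2 r : nat, (0 < r)%N & 2 * w0 ^+ r + w1 ^+ r + w2 ^+ r < 1.
Proof.
move=> /andP[w00 w01] /andP[w10 w11] /andP[w20 w21].
have small (w : R) : 0 <= w -> w < 1 ->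
    exists N, forall r, (N <= r)%N -> w ^+ r < 1 / 4.
  move=> w_0 w_1; have /cvgrPdist_lt/(_ (1 / 4)) : w ^+ r @[r --> \oo] --> (0 : R).
    by apply: cvg_expr; rewrite ger0_norm.
  have -> : (0 : R) < 1 / 4 by lra.
  move=> /(_ isT) [N _ H].
  exists N => r Nr; have := H r Nr; rewrite /= sub0r normrN ger0_norm // exprn_ge0 //.
have [N0 H0] := small _ w00 w01; have [N1 H1] := small _ w10 w11.
have [N2 H2] := small _ w20 w21.
exists (maxn N0 (maxn N1 N2)).+1 => //.
have h0 : w0 ^+ (maxn N0 (maxn N1 N2)).+1 < 1 / 4.
  by apply: H0; rewrite ltnW // ltnS leq_maxl.
have h1 : w1 ^+ (maxn N0 (maxn N1 N2)).+1 < 1 / 4.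
  by apply: H1; rewrite ltnW // ltnS !leq_max leqnn orbT.
have h2 : w2 ^+ (maxn N0 (maxn N1 N2)).+1 < 1 / 4.
  by apply: H2; rewrite ltnW // ltnS !leq_max leqnn !orbT.
lra.
Qed.

Lemma expR_le_inv (R : realType) (x : R) (N : nat) : (0 < N)%N -> x < N%:R ->
  expR x <= (1 - x / N%:R) ^- N.
Proof.
move=> N0 xN; have NR0 : 0 < N%:R :> R by rewrite ltr0n.
have q0 : 0 < 1 - x / N%:R by rewrite subr_gt0 ltr_pdivrMr // mul1r.
rewrite -[x in expR x]opprK expRN lef_pV2 ?posrE ?expR_gt0 ?exprn_gt0 //.
have -> : expR (- x) = expR (- (x / N%:R)) ^+ N.
  by rewrite -expRM_natr mulNr divfK ?gt_eqF.
by rewrite lerXn2r ?nnegrE ?expR_ge0 ?(ltW q0) // expR_ge1Dx.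
Qed.

Lemma le_expR_pow (R : realType) (x : R) (N : nat) : (0 < N)%N -> - N%:R <= x ->
  (1 + x / N%:R) ^+ N <= expR x.
Proof.
move=> N0 xN; have NR0 : 0 < N%:R :> R by rewrite ltr0n.
have -> : expR x = expR (x / N%:R) ^+ N by rewrite -expRM_natr divfK ?gt_eqF.
rewrite lerXn2r ?nnegrE ?expR_ge0 ?expR_ge1Dx //.
by rewrite -(pmulr_lge0 _ NR0) mulrDl divfK ?gt_eqF // mul1r -lerBlDl sub0r.
Qed.

Lemma expR_quarter_lt (R : realType) : expR (1 / 4 : R) < 13 / 10.
Proof.
have := @expR_le_inv R (1 / 4) 4 isT; have -> : (1 : R) / 4 < 4%:R by lra.
move=> /(_ isT)/le_lt_trans; apply.
have -> : (1 - 1 / 4 / 4%:R : R) = 15 / 16 by field.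
by rewrite expr_div_n invf_div; lra.
Qed.

Lemma expR_three_eighths_gt (R : realType) : 10 / 7 < expR (3 / 8 : R).
Proof.
have := @le_expR_pow R (3 / 8) 4 isT; have -> : - 4%:R <= (3 : R) / 8 by lra.
move=> /(_ isT); apply: lt_le_trans.
have -> : (1 + 3 / 8 / 4%:R : R) = 35 / 32 by field.
by rewrite expr_div_n; lra.
Qed.

Lemma expR_35_quarters_lt (R : realType) : expR (35 / 4 : R) < 128 * (12 / 5) ^+ 5.
Proof.
have -> : (35 / 4 : R) = 1 / 4 * 35%:R by field.
rewrite expRM_natr; have E0 := expR_ge0 (1 / 4 : R).
apply: (@le_lt_trans _ _ ((13 / 10) ^+ 35)).
  by rewrite lerXn2r ?nnegrE ?divr_ge0 // ltW // expR_quarter_lt.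
rewrite (_ : 35%N = (5 * 7)%N) // exprM.
(* Rounding the intermediate powers keeps the numerals short. *)
have h5 : (13 / 10 : R) ^+ 5 <= 93 / 25 by lra.
have h35 : ((13 / 10 : R) ^+ 5) ^+ 7 <= (93 / 25) ^+ 7.
  by rewrite lerXn2r ?nnegrE ?divr_ge0 // exprn_ge0 ?divr_ge0.
apply: le_lt_trans h35 _.
have h2 : (93 / 25 : R) ^+ 2 <= 346 / 25 by lra.
have h6 : ((93 / 25 : R) ^+ 2) ^+ 3 <= (346 / 25) ^+ 3.
  by apply: lerXn2r h2; rewrite nnegrE; lra.
have h3 : (346 / 25 : R) ^+ 3 <= 2652 by lra.
have h1 : (12 / 5 : R) ^+ 5 >= 79 by lra.
by rewrite exprSr (exprM _ 2 3); lra.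
Qed.

Lemma sum_ord1_pair (R : realType) (r : nat) (h : 'I_r * 'I_1 -> R) :
  \sum_ij h ij = \sum_i h (i, 0).
Proof.
rewrite (eq_bigr (fun ij => h (ij.1, ij.2))) => [|[]//].
by rewrite -(pair_big xpredT xpredT (fun i j => h (i, j))) /=;
  apply: eq_bigr => i _; rewrite big_ord1.
Qed.

Lemma enorm_sqr (R : realType) (n : nat) (u : 'cV[R]_n) :
  enorm u ^+ 2 = \sum_i u i 0 ^+ 2.
Proof. by rewrite enorm2 dotE; apply: eq_bigr => i _; rewrite expr2. Qed.

Section EmbeddingConstant.
Context {d : measure_display} {T : measurableType d} {R : realType}.
Context {Pr : probability T R} {X : nat -> {RV Pr >-> R}} {tau C0 : R}.
Hypotheses (X_iid : iid_normal X tau) (tau0 : 0 < tau).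
Hypothesis C0_spec : embedding_constant C0.

(** The embedding property of an r x 1 Gaussian matrix is a tail bound for a
    normalised chi-square variable; the r entries are rescaled terms of the
    sequence X. The value 19/20 of the relative error is chosen close to 1,
    where the bound is strongest. *)
Lemma embedding_chi2 (r : nat) (r0 : (0 < r)%N) : exists Y : 'I_r * 'I_1 -> {RV Pr >-> R},
  iid_normal Y (Num.sqrt r%:R)^-1 /\
  fine (Pr [set w | (2 <= \sum_ij Y ij w ^+ 2)%R]) <=
    2 * expR (- (C0 * (19 / 20) ^+ 2)) ^+ r.
Proof.
have sr0 : 0 < (Num.sqrt (r%:R : R))^-1 by rewrite invr_gt0 sqrtr_gt0 ltr0n.
pose c := (Num.sqrt (r%:R : R))^-1 / tau.
have c0 : 0 < c by rewrite divr_gt0.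
pose P' (i : 'I_r) (j : 'I_1) : {RV Pr >-> R} := scale_rv c (X i).
pose Y (ij : 'I_r * 'I_1) := P' ij.1 ij.2.
have inj : injective (fun ij : 'I_r * 'I_1 => nat_of_ord ij.1).
  by move=> [i j] [i' j'] /= /val_inj ->; rewrite !ord1.
have Yiid : iid_normal Y (Num.sqrt r%:R)^-1.
  have := iid_normal_scale c0 tau0 (iid_normal_reindex inj X_iid).
  by rewrite /c divfK ?gt_eqF.
exists Y; split => //.
have [C0gt0 /(_ r 1%N d T Pr P' (const_mx 1) (19 / 20) r0 isT Yiid)] := C0_spec.
have -> : (0 : R) < 19 / 20 by lra.
have -> : (19 / 20 : R) < 1 by lra.
move=> /(_ isT isT).
set G := [set w | _ /\ _]; pose B := [set w | 2 <= \sum_ij Y ij w ^+ 2].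
have Zw w : enorm (rmx P' w *m const_mx 1) ^+ 2 = \sum_ij Y ij w ^+ 2.
  rewrite enorm_sqr sum_ord1_pair; apply: eq_bigr => i _.
  by rewrite !mxE big_ord1 !mxE mulr1.
have n1 : enorm (const_mx 1 : 'cV[R]_1) ^+ 2 = 1.
  by rewrite enorm_sqr big_ord1 mxE expr1n.
have mZ : measurable_fun setT (fun w => \sum_ij Y ij w ^+ 2).
  by apply: measurable_sum => ij; exact: measurable_funX.
have GE : G = [set w | (1 - 19 / 20) * 1 <= \sum_ij Y ij w ^+ 2] `&`
              [set w | \sum_ij Y ij w ^+ 2 <= (1 + 19 / 20) * 1].
  by apply/seteqP; split=> w; rewrite /G /= Zw n1.
have mG : measurable G.
  by rewrite GE; apply: measurableI; exact: measurable_set_le.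
have mB : measurable B by exact: measurable_set_le.
have BG : B `<=` ~` G.
  by move=> w; rewrite GE /B /= => h [_]; lra.
move=> PG; have PB : (Pr B <= 1 - Pr G)%E.
  rewrite -probability_setC //; apply: le_measure => //; rewrite inE //.
  exact: measurableC.
rewrite -lee_fin fineK ?fin_num_measure //; apply: le_trans PB _.
rewrite -(fineK (fin_num_measure Pr _ mG)) in PG *.
rewrite lee_fin in PG; rewrite -EFinB lee_fin -expRM_natr mulNr; lra.
Qed.

Lemma sqrtV_sqr (q : R) : 0 < q -> (Num.sqrt q)^-1 ^+ 2 = q^-1.
Proof. by move=> q0; rewrite exprVn sqr_sqrtr // ltW. Qed.

Lemma lt1_expr (x : R) k : (0 < k)%N -> 0 <= x -> x ^+ k < 1 -> x < 1.
Proof.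
move=> k0 x0; rewrite !ltNge; apply: contra => x1.
by rewrite -(expr1n _ k) lerXn2r ?nnegrE.
Qed.

(** With weight rho = 7/24 the normalised chi-square law has mean
    1 / (1 - 2 rho) = 12/5, between a = 2 and b = 3. For h = 1/16,
    [chi2_upper_tail] and [embedding_chi2] give 1 <= 2 w0^r + w1^r + w2^r with
    w1, w2 < 1, where w0 is proportional to exp (- C0 (19/20)^2). The stated
    bound is what w0 >= 1 requires, up to rounding; if it failed, the right-hand
    side would be less than 1 for large r. *)
Lemma embedding_constant_ub : 1 / 128 <= expR (- (C0 * (19 / 20) ^+ 2)) ^+ 10.
Proof.
rewrite leNgt; apply/negP; set K := expR _ => K128.
have K0 : 0 < K by exact: expR_gt0.
pose a0 : R := (Num.sqrt (5 / 12))^-1.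
pose a1 : R := (Num.sqrt (13 / 24))^-1.
pose a2 : R := (Num.sqrt (7 / 24))^-1.
have pos (q : R) : 0 < q -> 0 < (Num.sqrt q)^-1 by move=> q0; rewrite invr_gt0 sqrtr_gt0.
have a00 : 0 < a0 by apply: pos; lra.
have a10 : 0 < a1 by apply: pos; lra.
have a20 : 0 < a2 by apply: pos; lra.
have a0E : a0 ^+ 2 = 12 / 5 by rewrite sqrtV_sqr ?invf_div //; lra.
have a1E : a1 ^+ 2 = 24 / 13 by rewrite sqrtV_sqr ?invf_div //; lra.
have a2E : a2 ^+ 2 = 24 / 7 by rewrite sqrtV_sqr ?invf_div //; lra.
pose w0 := expR (7 / 8) * K / a0; pose w1 := expR (1 / 8) * a1 / a0.
pose w2 := expR (- (3 / 16)) * a2 / a0.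
have w00 : 0 <= w0 by rewrite divr_ge0 ?mulr_ge0 ?expR_ge0 // ltW.
have w10 : 0 <= w1 by rewrite divr_ge0 ?mulr_ge0 ?expR_ge0 // ltW.
have w20 : 0 <= w2 by rewrite divr_ge0 ?mulr_ge0 ?expR_ge0 // ltW.
have w01 : w0 < 1.
  apply: (@lt1_expr _ 10) => //; rewrite expr_div_n exprMn.
  rewrite ltr_pdivrMr ?exprn_gt0 // mul1r (exprM a0 2 5) a0E.
  rewrite -expRM_natr (_ : 7 / 8 * 10%:R = 35 / 4); last by field.
  have E := expR_35_quarters_lt R; have E0 := expR_gt0 (35 / 4 : R).
  have h : expR (35 / 4) * K ^+ 10 < expR (35 / 4) * (1 / 128) by rewrite ltr_pM2l.
  apply: lt_trans h _; move: E; set D := (12 / 5) ^+ 5; lra.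
have w11 : w1 < 1.
  apply: (@lt1_expr _ 2) => //; rewrite expr_div_n exprMn a1E a0E -expRM_natr.
  rewrite (_ : 1 / 8 * 2%:R = 1 / 4); last by field.
  have := expR_quarter_lt R; lra.
have w21 : w2 < 1.
  apply: (@lt1_expr _ 2) => //; rewrite expr_div_n exprMn a2E a0E -expRM_natr.
  rewrite (_ : - (3 / 16) * 2%:R = - (3 / 8)); last by field.
  have := expR_three_eighths_gt R; rewrite expRN => h.
  have : (expR (3 / 8 : R))^-1 < 7 / 10.
    by rewrite -[7 / 10]invf_div ltf_pV2 ?posrE ?expR_gt0 //; lra.
  lra.
have [|||r r0 wr] := @geometric_sum_small R w0 w1 w2; try exact/andP.
have [Y [Yiid PY]] := embedding_chi2 r0.
have cA : #|{: 'I_r * 'I_1}| = r by rewrite card_prod !card_ord muln1.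
have := @chi2_upper_tail _ _ _ _ r _ Y (7 / 24) (1 / 16) 2 3 cA r0 Yiid.
have -> : (0 : R) <= 7 / 24 by lra.
have -> : (0 : R) <= 1 / 16 by lra.
have -> : 7 / 24 + 1 / 16 < (1 / 2 : R) by lra.
move=> /(_ isT isT isT).
rewrite (_ : 1 - 2 * (7 / 24) = 5 / 12); last by field.
rewrite (_ : 1 - 2 * (7 / 24 - 1 / 16) = 13 / 24); last by field.
rewrite (_ : 1 - 2 * (7 / 24 + 1 / 16) = 7 / 24); last by field.
rewrite -/a0 -/a1 -/a2.
rewrite (_ : 7 / 24 * r%:R * 3 = 7 / 8 * r%:R); last by field.
rewrite (_ : 1 / 16 * r%:R * 2 = 1 / 8 * r%:R); last by field.
rewrite (_ : - (1 / 16 * r%:R * 3) = - (3 / 16) * r%:R); last by field.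
rewrite !expRM_natr; apply/negP; rewrite -ltNge.
apply: (@le_lt_trans _ _ (a0 ^+ r * (2 * w0 ^+ r + w1 ^+ r + w2 ^+ r))).
  rewrite !mulrDr; have wE (x y : R) : a0 ^+ r * (x * y / a0) ^+ r = x ^+ r * y ^+ r.
    by rewrite -exprMn mulrC divfK ?gt_eqF // exprMn.
  rewrite mulrCA !wE lerD2r lerD2r mulrCA ler_wpM2l ?exprn_ge0 ?expR_ge0 //.
by rewrite -[ltRHS]mulr1 ltr_pM2l // exprn_gt0.
Qed.

(** If delta_s < 1 then exp (- C0 s / 4) < 1/2, so that s <= 5 gives
    exp (- 5 C0 / 4) < 1/2. This contradicts [embedding_constant_ub], since
    128 = 2^7 and 10 (19/20)^2 > 7 (5/4). *)
Lemma embedding_dim_ge6 (s : nat) : (0 < 1 - delta_s s C0) -> (6 <= s)%N.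
Proof.
rewrite /delta_s leqNgt => ds; apply/negP => s6.
have C0gt0 := C0_spec.1.
have := embedding_constant_ub; apply/negP; rewrite -ltNge.
have s5 : s%:R <= 5 :> R by rewrite (ler_nat _ s 5) -ltnS.
have e1 : expR (- (C0 * (5 / 4))) < 1 / 2.
  apply: (@le_lt_trans _ _ (expR (- (C0 / 4 * s%:R)))).
    by rewrite ler_expR lerN2; nra.
  have := expR_gt0 (- s%:R : R); lra.
apply: (@le_lt_trans _ _ (expR (- (C0 * (5 / 4))) ^+ 7)).
  rewrite -!expRM_natr ler_expR; lra.
have : (1 / 128 : R) = (1 / 2) ^+ 7 by field.
by move=> ->; rewrite ltrXn2r // ?nnegrE ?expR_ge0 //; lra.
Qed.

End EmbeddingConstant.

(** * Measurability of the iteration *)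

Section RationalVectors.
Context {R : realType} {n : nat}.

Definition ratv (q : 'cV[rat]_n) : 'cV[R]_n := map_mx ratr q.

Lemma ratv_dense (x : 'cV[R]_n) (e : R) : 0 < e -> exists q, ball x e (ratv q).
Proof.
move=> e0.
have H i : exists q : rat, `|x i 0 - ratr q| < e.
  have /rat_in_itvoo[q] : x i 0 - e < x i 0 + e by rewrite ltrBlDr -addrA ltrDl addr_gt0.
  by rewrite in_itv /= => /andP[q1 q2]; exists q; rewrite ltr_distlC q1.
have [q Hq] := choice H.
exists (\col_i q i); rewrite mx_norm_ball /ball_ /=.
apply: (@le_lt_trans _ _ (\big[Num.max/0]_i `|x i 0 - ratr (q i)|)).
  apply: norm_mx_le => [|i j]; first exact: bigmax_ge_id.
  by rewrite !mxE (ord1 j); exact: le_bigmax.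
by apply/bigmax_ltP; split.
Qed.

(** Replaces a condition on all vectors by countably many, which makes events
    defined by quadratic forms measurable. *)
Lemma continuous_rat_ge0 (h : 'cV[R]_n -> R) : continuous h ->
  (forall q, 0 <= h (ratv q)) -> forall x, 0 <= h x.
Proof.
move=> ch hq x; rewrite leNgt; apply/negP => hx.
have hx0 : 0 < - h x by rewrite oppr_gt0.
have /cvgrPdist_lt/(_ _ hx0)/nbhs_ballP[r r0 H] := ch x.
have [q xq] := ratv_dense x r0.
have := H _ xq; rewrite /= => /ltr_normlP[+ _].
by rewrite opprB => h1; have := hq q; lra.
Qed.

End RationalVectors.

Section MeasurableMatrices.
Context {d : measure_display} {T : measurableType d} {R : realType}.

Definition measurable_mx m n (A : T -> 'M[R]_(m, n)) :=
  forall i j, measurable_fun setT (fun w => A w i j).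

Lemma measurable_mx_cst m n (A : 'M[R]_(m, n)) : measurable_mx (fun=> A).
Proof. by move=> i j; exact: measurable_cst. Qed.

Lemma measurable_mxM m n p (A : T -> 'M[R]_(m, n)) (B : T -> 'M[R]_(n, p)) :
  measurable_mx A -> measurable_mx B -> measurable_mx (fun w => A w *m B w).
Proof.
move=> mA mB i j; under eq_fun do rewrite mxE.
by apply: measurable_sum => k; exact: measurable_funM.
Qed.

Lemma measurable_mxD m n (A B : T -> 'M[R]_(m, n)) :
  measurable_mx A -> measurable_mx B -> measurable_mx (fun w => A w + B w).
Proof. by move=> mA mB i j; under eq_fun do rewrite mxE; exact: measurable_funD. Qed.

Lemma measurable_mxN m n (A : T -> 'M[R]_(m, n)) :
  measurable_mx A -> measurable_mx (fun w => - A w).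
Proof. by move=> mA i j; under eq_fun do rewrite mxE; exact: measurable_funN. Qed.

Lemma measurable_mx_tr m n (A : T -> 'M[R]_(m, n)) :
  measurable_mx A -> measurable_mx (fun w => (A w)^T).
Proof. by move=> mA i j; under eq_fun do rewrite mxE; exact: mA. Qed.

Lemma measurable_mxZ m n (a : T -> R) (A : T -> 'M[R]_(m, n)) :
  measurable_fun setT a -> measurable_mx A -> measurable_mx (fun w => a w *: A w).
Proof. by move=> ma mA i j; under eq_fun do rewrite mxE; exact: measurable_funM. Qed.

Lemma measurable_det n (A : T -> 'M[R]_n) :
  measurable_mx A -> measurable_fun setT (fun w => \det (A w)).
Proof.
move=> mA; rewrite /determinant; apply: measurable_sum => s.
apply: measurable_funM => //.
by apply: measurable_prod => i _; exact: mA.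
Qed.

(** Real powers are measurable, and a * (a^2)^(-1) is the inverse of a even at
    a = 0. *)
Lemma measurable_inv (a : T -> R) :
  measurable_fun setT a -> measurable_fun setT (fun w => (a w)^-1).
Proof.
move=> ma; have -> : (fun w => (a w)^-1) = (fun w => a w * (a w ^+ 2) `^ (-1)).
  apply/funext => w; rewrite powR_inv1 ?sqr_ge0 //.
  have [->|a0] := eqVneq (a w) 0; first by rewrite invr0 mul0r.
  by field.
apply: measurable_funM => //.
apply: (measurableT_comp (measurable_powR _)).
exact: measurable_funX.
Qed.

(** Cramer's formula applies off the zero set of the determinant, on which
    invmx returns its argument. *)
Lemma measurable_invmx n (A : T -> 'M[R]_n) :
  measurable_mx A -> measurable_mx (fun w => invmx (A w)).
Proof.
move=> mA i j.
have -> : (fun w => invmx (A w) i j) =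
    (fun w => if \det (A w) == 0 then A w i j
              else (\det (A w))^-1 * cofactor (A w) j i).
  apply/funext => w; rewrite /invmx unitmxE unitfE.
  by case: eqP => //= _; rewrite !mxE.
apply: measurable_fun_ifT; last 1 first.
- apply: measurable_funM; first exact/measurable_inv/measurable_det.
  rewrite /cofactor; apply: measurable_funM => //.
  by apply: measurable_det => k l; under eq_fun do rewrite !mxE; exact: mA.
- by apply: measurable_fun_eqr => //; exact: measurable_det.
- exact: mA.
Qed.

Lemma measurable_dot n (u v : T -> 'cV[R]_n) :
  measurable_mx u -> measurable_mx v -> measurable_fun setT (fun w => dot (u w) (v w)).
Proof.
move=> mu mv; under eq_fun do rewrite dotE.
by apply: measurable_sum => i; exact: measurable_funM.
Qed.

Lemma measurable_enorm n (u : T -> 'cV[R]_n) :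
  measurable_mx u -> measurable_fun setT (fun w => enorm (u w)).
Proof.
move=> mu; under eq_fun do rewrite /enorm -powR12_sqrt ?dot_ge0 //.
by apply: (measurableT_comp (measurable_powR _)); exact: measurable_dot.
Qed.

(** Open sets are countable unions of balls with rational data, so continuity
    is compatible with coordinatewise measurability. *)
Lemma measurable_continuous_comp n (h : 'cV[R]_n -> R) (u : T -> 'cV[R]_n) :
  continuous h -> measurable_mx u -> measurable_fun setT (fun w => h (u w)).
Proof.
move=> ch mu; apply: (measurability _ (RGenOInfty.measurableE R)).
move=> _ [_ [a ->] <-]; rewrite setTI.
pose O := [set x | a < h x].
pose F (qr : 'cV[rat]_n * rat) := [set w | ball (ratv qr.1) (ratr qr.2) (u w) /\
  ball (ratv qr.1) (ratr qr.2) `<=` O].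
have -> : (fun w => h (u w)) @^-1` `]a, +oo[ = \bigcup_qr F qr.
  apply/seteqP; split=> w /=; last first.
    by move=> [qr _ [uw sub]]; rewrite in_itv /= andbT; exact: sub.
  rewrite in_itv /= andbT => ahw.
  have ha : 0 < h (u w) - a by rewrite subr_gt0.
  have /cvgrPdist_lt/(_ _ ha)/nbhs_ballP[r r0 H] := ch (u w).
  have r20 : 0 < r / 2 by rewrite divr_gt0.
  have [e /andP[e0 er]] : exists e : rat, 0 < (ratr e : R) < r / 2.
    by have [e] := rat_in_itvoo r20; rewrite in_itv /= => ?; exists e.
  have [q uq] := ratv_dense (u w) e0.
  exists (q, e) => //; split; first exact: ball_sym.
  move=> y qy; have uy : ball (u w) r y.
    rewrite (splitr r); apply: ball_triangle (le_ball (ltW er) uq) _.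
    exact: le_ball (ltW er) _ qy.
  by have := H _ uy; rewrite /= /O /= => /ltr_normlP[]; lra.
apply: countable_bigcupT_measurable => [|[q r]]; first exact: countableP.
have [sub|nsub] := pselect (ball (ratv q : 'cV[R]_n) (ratr r) `<=` O); last first.
  rewrite (_ : F _ = set0) //; apply/seteqP; split => // w [_].
  by [].
have -> : F (q, r) = \bigcap_i [set w | `|ratr (q i 0) - u w i 0| < ratr r]
    `&` [set w | 0 < (ratr r : R)].
  apply/seteqP; split=> w /=.
    by move=> [[r0 H] _]; split => // i _; have := H i 0; rewrite mxE.
  move=> [H r0]; split => //; split => // i j; rewrite (ord1 j) mxE.
  exact: H.
apply: measurableI; last first.
  by have [_|_] := boolP (0 < (ratr r : R)); rewrite ?set_true ?set_false.
apply: fin_bigcap_measurable => [|i _]; first exact: finite_finset.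
rewrite -[X in measurable X]setTI.
have m1 : measurable_fun setT (fun w => `|ratr (q i 0) - u w i 0|).
  by apply: measurableT_comp => //; apply: measurable_funB.
exact: (measurable_fun_ltr m1 (measurable_cst _) measurableT (Y := [set true])).
Qed.

(** By [le_lambda_min] a lower bound a on the least eigenvalue says that the
    form of A - a is nonnegative, which can be tested on rational vectors. *)
Lemma measurable_lambda_min n (A : T -> 'M[R]_n) : (0 < n)%N ->
  (forall w, (A w)^T = A w) -> measurable_mx A ->
  measurable_fun setT (fun w => lambda_min (A w)).
Proof.
move=> n0 Asym mA; apply: (measurability (@RGenCInfty.G R)).
  exact: RGenCInfty.measurableE.
move=> _ [_ [a ->] <-]; rewrite setTI.
have -> : (fun w => lambda_min (A w)) @^-1` `[a, +oo[ =
    ~` \bigcup_q ~` [set w | 0 <= dot (ratv q : 'cV[R]_n) ((A w - a%:M) *m ratv q)].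
  rewrite setC_bigcup; apply/seteqP; split=> w /=; rewrite in_itv /= andbT.
    move=> /(le_lambda_min _ n0 (Asym w)) H q _; rewrite setCK /=.
    by rewrite mulmxBl mul_scalar_mx dotBr dotZr subr_ge0.
  move=> H; apply/(le_lambda_min _ n0 (Asym w)) => u.
  rewrite -subr_ge0 -dotZr -dotBr -mul_scalar_mx -mulmxBl.
  apply: (@continuous_rat_ge0 _ _ (fun v => dot v ((A w - a%:M) *m v))) => [|q].
    exact: continuous_dot_mul.
  by have := H q I; rewrite setCK.
apply: measurableC; apply: countable_bigcupT_measurable => [|q]; first exact: countableP.
apply: measurableC; apply: measurable_set_le => //.
apply: measurable_dot; first exact: measurable_mx_cst.
apply: measurable_mxM; last exact: measurable_mx_cst.
apply: measurable_mxD => //; exact: measurable_mx_cst.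
Qed.

(** Likewise with the form of c^2 - A^T A. *)
Lemma measurable_opnorm_le m n (A : T -> 'M[R]_(m, n)) (c : R) : 0 <= c ->
  measurable_mx A -> measurable [set w | opnorm (A w) <= c].
Proof.
move=> c0 mA.
pose Q w := (c ^+ 2)%:M - (A w)^T *m A w.
have QE w u : dot u (Q w *m u) = c ^+ 2 * enorm u ^+ 2 - enorm (A w *m u) ^+ 2.
  rewrite /Q mulmxBl mul_scalar_mx dotBr dotZr !enorm2; congr (_ - _).
  by rewrite -mulmxA -dot_mull.
have -> : [set w | opnorm (A w) <= c] =
    ~` \bigcup_q ~` [set w | 0 <= dot (ratv q : 'cV[R]_n) (Q w *m ratv q)].
  rewrite setC_bigcup; apply/seteqP; split=> w /=.
    move=> H q _; rewrite setCK /= QE subr_ge0 -exprMn.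
    rewrite lerXn2r ?nnegrE ?mulr_ge0 ?enorm_ge0 //.
    by apply: le_trans (enorm_mul_opnorm _ _) _; rewrite ler_wpM2r ?enorm_ge0.
  move=> H; apply: opnorm_le => // v.
  rewrite -ler_sqr ?nnegrE ?mulr_ge0 ?enorm_ge0 // exprMn -subr_ge0 -QE.
  apply: (@continuous_rat_ge0 _ _ (fun v => dot v (Q w *m v))) => [|q].
    exact: continuous_dot_mul.
  by have := H q I; rewrite setCK.
apply: measurableC; apply: countable_bigcupT_measurable => [|q]; first exact: countableP.
apply: measurableC; apply: measurable_set_le => //.
apply: measurable_dot; first exact: measurable_mx_cst.
apply: measurable_mxM; last exact: measurable_mx_cst.
apply: measurable_mxD; first exact: measurable_mx_cst.
by apply: measurable_mxN; apply: measurable_mxM => //; exact: measurable_mx_tr.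
Qed.

End MeasurableMatrices.

Section MeasurableStep.
Context {d : measure_display} {T : measurableType d} {R : realType} {n s : nat}.
Context {f : 'cV[R]_n -> R} {gamma c1 c2 alpha beta : R}.
Hypothesis (s_gt0 : (0 < s)%N).
Hypothesis f_C2 : twice_continuously_differentiable f.
Context {x : T -> 'cV[R]_n} {P : T -> 'M[R]_(s, n)}.
Hypotheses (mx : measurable_mx x) (mP : measurable_mx P).

Lemma measurable_objective : measurable_fun setT (fun w => f (x w)).
Proof.
apply: measurable_continuous_comp => // y.
by apply: differentiable_continuous; case: f_C2.
Qed.

Lemma measurable_grad : measurable_mx (fun w => grad f (x w)).
Proof.
move=> i j; apply: (measurable_continuous_comp (h := fun y => grad f y i j)) => //.
move=> y; apply: (continuous_comp (g := fun M : 'cV[R]_n => M i j)).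
  by apply: differentiable_continuous; case: f_C2.
exact: coord_continuous.
Qed.

Lemma measurable_hessian : measurable_mx (fun w => hessian f (x w)).
Proof.
have [_ _ cH] := f_C2.
move=> i j; apply: (measurable_continuous_comp (h := fun y => hessian f y i j)) => //.
move=> y; apply: (continuous_comp (cH y) (g := fun M : 'M[R]_n => M i j)).
exact: coord_continuous.
Qed.

Let msk : measurable_mx (fun w => sketched_hessian f (P w) (x w)).
Proof.
apply: measurable_mxM; last exact: measurable_mx_tr.
by apply: measurable_mxM => //; exact: measurable_hessian.
Qed.

Let meta : measurable_fun setT (fun w => Defs.eta f gamma c1 c2 (P w) (x w)).
Proof.
rewrite /Defs.eta; apply: measurable_funD; apply: measurable_funM => //.
  rewrite /Lambda; apply: measurable_maxr => //.
  apply: measurableT_comp => //; apply: measurable_lambda_min => // w.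
  by rewrite /sketched_hessian !trmx_mul trmxK (hessian_sym f_C2) mulmxA.
apply: (measurableT_comp (measurable_powR _)).
exact/measurable_enorm/measurable_grad.
Qed.

Lemma measurable_direction :
  measurable_mx (fun w => direction f gamma c1 c2 (P w) (x w)).
Proof.
rewrite /direction; apply: measurable_mxN.
apply: measurable_mxM; last exact: measurable_grad.
apply: measurable_mxM => //; apply: measurable_mxM; first exact: measurable_mx_tr.
apply: measurable_invmx; rewrite /regularized_hessian; apply: measurable_mxD => //.
move=> i j; under eq_fun do rewrite mxE -mulr_natr.
exact: measurable_funM.
Qed.

Let dd w := direction f gamma c1 c2 (P w) (x w).

Lemma measurable_armijo l :
  measurable [set w | armijo f alpha beta (x w) (dd w) l].
Proof.
rewrite /armijo; apply: measurable_set_le.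
  apply: measurable_funN; apply: measurable_funM => //.
  by apply: measurable_dot; [exact: measurable_grad|exact: measurable_direction].
apply: measurable_funB; first exact: measurable_objective.
apply: measurable_continuous_comp => [y|].
  by apply: differentiable_continuous; case: f_C2.
apply: measurable_mxD => //.
by apply: measurable_mxZ => //; exact: measurable_direction.
Qed.

(** The next iterate is one of countably many measurable functions, selected
    by the measurable event on which a given l is the Armijo exponent. *)
Lemma measurable_next (x' : T -> 'cV[R]_n) :
  (forall w, exists2 l, least_armijo f alpha beta (x w) (dd w) l &
    x' w = x w + beta ^+ l *: dd w) -> measurable_mx x'.
Proof.
move=> Hx' i j _ B mB; rewrite setTI.
pose A l := [set w | armijo f alpha beta (x w) (dd w) l].
pose C l w := (x w + beta ^+ l *: dd w) i j.
have -> : (fun w => x' w i j) @^-1` B =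
   \bigcup_l (A l `&` \bigcap_(k in [set k | (k < l)%N]) ~` A k `&` C l @^-1` B).
  apply/seteqP; split=> w /=.
    move=> xB; have [l [al lmin] E] := Hx' w; exists l => //; split.
      split => // k /= kl ak; have := lmin k ak.
      by rewrite leqNgt kl.
    by rewrite /C /= -E.
  move=> [l _ [[al lmin] CB]].
  have [l' [al' lmin'] E] := Hx' w.
  suff ll : l' = l by move: CB; rewrite /= /C /= -ll -E.
  apply/eqP; rewrite eqn_leq lmin' //= leqNgt; apply/negP => l'l.
  exact: (lmin l').
apply: bigcup_measurable => l _; apply: measurableI.
  apply: measurableI; first exact: measurable_armijo.
  apply: bigcap_measurableType => k _; apply: measurableC.
  exact: measurable_armijo.
rewrite -[X in measurable X]setTI.
have : measurable_fun setT (C l); last exact.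
apply: (measurable_mxD mx (measurable_mxZ (measurable_cst _) measurable_direction)).
Qed.

End MeasurableStep.

(** * Exponential moments along the iteration *)

(** With a = e^(1/4) / sqrt 2 and b = e^(-3/4), both at most 1, the left-hand
    side is a^s + 2 b^s, so that s = 6 is the worst case. There
    a^6 = e^(-1/2) e^2 / 8 and b^6 = e^(-1/2) e^(-4), and
    e^2 / 8 + 2 e^(-4) < 1. *)
Lemma chernoff_rate (R : realType) (s : nat) : (6 <= s)%N ->
  expR (s%:R / 4) * ((Num.sqrt 2)^-1 ^+ s + 2 * expR (- s%:R)) <= expR (- (1 / 2)) :> R.
Proof.
move=> s6.
have e1ub : expR 1 <= 275 / 100 :> R.
  have := @expR_le_inv R 1 64 isT; have -> : (1 : R) < 64%:R by rewrite ltr1n.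
  move=> /(_ isT) h; apply: le_trans h _.
  have -> : (1 - 1 / 64%:R : R) = 63 / 64 by field.
  have h4 : 9389 / 10000 <= (63 / 64 : R) ^+ 4 by lra.
  have h16 : 777 / 1000 <= (63 / 64 : R) ^+ 16.
    rewrite (exprM _ 4 4); apply: (@le_trans _ _ ((9389 / 10000) ^+ 4)); first by lra.
    by apply: lerXn2r h4; rewrite nnegrE; lra.
  have h64 : 4 / 11 <= (63 / 64 : R) ^+ 64.
    rewrite (exprM _ 16 4); apply: (@le_trans _ _ ((777 / 1000) ^+ 4)); first by lra.
    by apply: lerXn2r h16; rewrite nnegrE; lra.
  have -> : (275 / 100 : R) = (4 / 11)^-1 by field.
  by rewrite lef_pV2 ?posrE //; lra.
have e1lb : 25 / 10 <= expR 1 :> R.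
  have := @le_expR_pow R 1 8 isT; have -> : - 8%:R <= (1 : R) by lra.
  move=> /(_ isT); apply: le_trans.
  have -> : (1 + 1 / 8%:R : R) = 9 / 8 by field.
  lra.
pose a : R := expR (1 / 4) * (Num.sqrt 2)^-1; pose b : R := expR (- (3 / 4)).
have sq2 : (Num.sqrt 2 : R)^-1 ^+ 2 = 2^-1 by rewrite sqrtV_sqr.
have a0 : 0 <= a by rewrite mulr_ge0 ?expR_ge0 // invr_ge0 sqrtr_ge0.
have b0 : 0 <= b by exact: expR_ge0.
have E2 : expR (1 / 2) ^+ 2 = expR 1 :> R.
  by rewrite -expRM_natr; congr expR; field.
have E0 : 0 < expR (1 / 2) :> R by exact: expR_gt0.
have a2 : a ^+ 2 = expR (1 / 2) / 2.
  by rewrite exprMn sq2 -expRM_natr; congr (expR _ * _); field.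
have E12 : expR (1 / 2) <= 2 :> R.
  rewrite -(@ler_sqr _ _ 2) ?nnegrE ?expR_ge0 // E2; lra.
have a1 : a <= 1.
  rewrite -(@expr_le1 _ 2) // a2; lra.
have b1 : b <= 1 by rewrite -expR0 ler_expR; lra.
have -> : expR (s%:R / 4) * ((Num.sqrt 2)^-1 ^+ s + 2 * expR (- s%:R)) =
    a ^+ s + 2 * b ^+ s :> R.
  rewrite mulrDr mulrCA -expRD /a exprMn /b -!expRM_natr.
  by congr (expR _ * _ + 2 * expR _); field.
have as6 : a ^+ s <= a ^+ 6 by rewrite ler_wiXn2l.
have bs6 : b ^+ s <= b ^+ 6 by rewrite ler_wiXn2l.
have a6 : a ^+ 6 = expR (1 / 2) * expR 1 / 8.
  by rewrite (exprM _ 2 3) a2 -E2; field.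
have b6 : b ^+ 6 = expR (- (1 / 2)) * expR (- 1) ^+ 4.
  by rewrite /b -!expRM_natr -expRD; congr expR; field.
have en : expR (- 1) <= 10 / 25 :> R.
  by rewrite expRN -[10 / 25]invf_div lef_pV2 ?posrE ?expR_gt0 //; lra.
have en4 : expR (- 1) ^+ 4 <= (10 / 25) ^+ 4 :> R.
  by apply: lerXn2r en; rewrite nnegrE ?expR_ge0 //; lra.
have a6' : a ^+ 6 = expR (- (1 / 2)) * (expR 1 ^+ 2 / 8).
  rewrite a6 -{1}[expR (1 / 2)](mulfK (x := expR (1 / 2))) ?gt_eqF //.
  by rewrite -[_ * expR (1 / 2)]expr2 E2 expRN; field; rewrite gt_eqF.
have e2 : expR 1 ^+ 2 <= (275 / 100) ^+ 2 :> R.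
  by apply: lerXn2r e1ub; rewrite nnegrE ?expR_ge0 //; lra.
apply: (le_trans (lerD as6 (ler_wpM2l (ler0n _ 2) bs6))).
rewrite a6' b6 [2 * _]mulrCA -mulrDr ler_piMr ?expR_ge0 //; lra.
Qed.

Section Iteration.
Context {d : measure_display} {T : measurableType d} {R : realType}.
Context {Pr : probability T R} {n s : nat}.
Context {P : nat -> 'I_s -> 'I_n -> {RV Pr >-> R}} {x : nat -> T -> 'cV[R]_n}.
Context {f : 'cV[R]_n -> R} {x0 : 'cV[R]_n} {gamma c1 c2 alpha beta Cbar : R}.
Hypotheses (s_gt0 : (0 < s)%N).
Hypothesis f_C2 : twice_continuously_differentiable f.
Hypothesis P_gauss : gaussian_mx_seq P.
Hypothesis x_alg : forall w, rs_rnm f gamma c1 c2 alpha beta x0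
  (fun k => rmx (P k) w) (fun k => x k w).
Hypothesis Cbar_spec : gram_norm_constant s n Cbar.

Let X (kij : nat * ('I_s * 'I_n)) : {RV Pr >-> R} := P kij.1 kij.2.1 kij.2.2.

Definition past k : set (nat * ('I_s * 'I_n)) := [set kij | (kij.1 < k)%N].
Definition present k : set (nat * ('I_s * 'I_n)) := [set kij | kij.1 = k].

Let sR_gt0 : 0 < s%:R :> R. Proof. by rewrite ltr0n. Qed.

Let sigma_gt0 : 0 < (Num.sqrt (s%:R : R))^-1.
Proof. by rewrite invr_gt0 sqrtr_gt0. Qed.

Let past_present k : past k `&` present k = set0.
Proof.
by apply/seteqP; split => // kij [+ E]; rewrite /past /= E ltnn.
Qed.

Let mono_past k : past k `<=` past k.+1.
Proof. by move=> [k' ij]; rewrite /past /= => /ltnW. Qed.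

Let mono_present k : present k `<=` past k.+1.
Proof. by move=> [k' ij]; rewrite /past /present /= => ->. Qed.

Let lift_past k (g : T -> R) :
  measurable_fun setT (g : info X (past k) -> R) ->
  measurable_fun setT (g : info X (past k.+1) -> R).
Proof. exact: measurable_info_mono (@mono_past k). Qed.

Let lift_present k (g : T -> R) :
  measurable_fun setT (g : info X (present k) -> R) ->
  measurable_fun setT (g : info X (past k.+1) -> R).
Proof. exact: measurable_info_mono (@mono_present k). Qed.

Lemma measurable_sketch k : @measurable_mx _ (info X (present k)) R _ _ (rmx (P k)).
Proof.
move=> i j; under eq_fun do rewrite mxE.
exact: (@measurable_info_X _ _ _ _ _ X (present k) (k, (i, j))).
Qed.

(** The iterate is a function of the earlier matrices, hence independent of the
    matrix that is drawn next. *)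
Lemma measurable_iterate k : @measurable_mx _ (info X (past k)) R _ _ (x k).
Proof.
elim: k => [|k ih].
  have -> : x 0%N = fun=> x0 by apply/funext => w; have [] := x_alg w.
  exact: measurable_mx_cst.
apply: (@measurable_next _ (info X (past k.+1)) _ _ _ _ gamma c1 c2 alpha beta
  s_gt0 f_C2 (x k) (rmx (P k))).
- by move=> i j; exact: (@lift_past k (fun w => x k w i j) (ih i j)).
- by move=> i j; exact: (@lift_present k (fun w => rmx (P k) w i j) (@measurable_sketch k i j)).
- by move=> w; have [_ /(_ k)] := x_alg w.
Qed.

Lemma gaussian_sketch k : gaussian_mx (P k).
Proof.
have inj : injective (pair k : 'I_s * 'I_n -> nat * ('I_s * 'I_n)) by move=> a b [].
exact: (iid_normal_reindex inj P_gauss).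
Qed.

Lemma laplace_sketch k (u : 'cV[R]_n) : dot u u = 1 ->
  (\int[Pr]_v (expR (- (s%:R / 2 * enorm (rmx (P k) v *m u) ^+ 2)))%:E =
   ((Num.sqrt 2)^-1 ^+ s)%:E)%E.
Proof.
move=> u1.
have lam0 : 0 <= s%:R / 2 :> R by rewrite divr_ge0.
have := laplace_matrix (gaussian_sketch k) sigma_gt0 (fun j => u j 0) lam0.
have -> : 1 + 2 * (s%:R / 2) * (Num.sqrt s%:R)^-1 ^+ 2 * \sum_j u j 0 ^+ 2 = 2 :> R.
  rewrite sqrtV_sqr // -enorm_sqr enorm2 u1; field.
  by rewrite gt_eqF.
move=> <-; apply: eq_integral => v _; rewrite enorm_sqr.
congr (expR (- (_ * _)))%:E; apply: eq_bigr => i _; rewrite mxE; congr (_ ^+ 2).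
by apply: eq_bigr => j _; rewrite mxE mulrC.
Qed.

Let good k := [set w | opnorm (rmx (P k) w *m (rmx (P k) w)^T) <= Cbar * (n%:R / s%:R)].

Let bound_ge0 : 0 <= Cbar * (n%:R / s%:R).
Proof. by rewrite mulr_ge0 ?divr_ge0 // ltW // Cbar_spec.1. Qed.

Lemma measurable_good k : @measurable _ (info X (present k)) (good k).
Proof.
apply: measurable_opnorm_le => //; apply: measurable_mxM.
  exact: measurable_sketch.
by apply: measurable_mx_tr; exact: measurable_sketch.
Qed.

Let goodT k : measurable (good k).
Proof. by have := @info_measurable _ _ _ _ _ X (present k) (good k) (@measurable_good k). Qed.

Lemma bad_prob k : (Pr (~` good k) <= (2 * expR (- s%:R))%:E)%E.
Proof.
have [_ /(_ _ _ Pr (P k) (gaussian_sketch k)) h] := Cbar_spec.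
rewrite probability_setC //.
move: h; rewrite -/(good k) -(fineK (fin_num_measure Pr _ (goodT k))) lee_fin => h.
by rewrite -EFinB lee_fin; lra.
Qed.

(** The normalised gradient; a fixed unit vector stands for it where the
    gradient vanishes. *)
Definition unit_grad (i0 : 'I_n) k w : 'cV[R]_n :=
  if enorm (grad f (x k w)) == 0 then delta_mx i0 0
  else (enorm (grad f (x k w)))^-1 *: grad f (x k w).

Lemma unit_gradK i0 k w :
  enorm (grad f (x k w)) *: unit_grad i0 k w = grad f (x k w).
Proof.
rewrite /unit_grad; case: eqP => [E|/eqP E].
  by rewrite E scale0r; apply/esym/eqP; rewrite -enorm_eq0 E.
by rewrite scalerA divff // scale1r.
Qed.

Lemma unit_grad1 i0 k w : dot (unit_grad i0 k w) (unit_grad i0 k w) = 1.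
Proof.
rewrite /unit_grad; case: eqP => [E|/eqP E].
  rewrite dotE (bigD1 i0) //= !mxE !eqxx mulr1 big1 ?addr0 // => i i0i.
  by rewrite !mxE (negbTE i0i) mul0r.
by rewrite dotZl dotZr -enorm2 expr2; field.
Qed.

Lemma measurable_unit_grad i0 k :
  @measurable_mx _ (info X (past k)) R _ _ (unit_grad i0 k).
Proof.
have mg : @measurable_mx _ (info X (past k)) R _ _ (fun w => grad f (x k w)).
  exact: (measurable_grad f_C2 (@measurable_iterate k)).
have me : measurable_fun setT ((fun w => enorm (grad f (x k w))) : info X (past k) -> R).
  exact: measurable_enorm.
move=> i j.
have -> : (fun w => unit_grad i0 k w i j) = (fun w =>
    if enorm (grad f (x k w)) == 0 then (delta_mx i0 0 : 'cV[R]_n) i j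
    else (enorm (grad f (x k w)))^-1 * grad f (x k w) i j).
  by apply/funext => w; rewrite /unit_grad; case: ifP => // _; rewrite mxE.
apply: measurable_fun_ifT => //.
- exact: measurable_fun_eqr.
- by apply: measurable_funM => //; exact: measurable_inv.
Qed.

(** A lower bound, up to the factor 2 p, for the decrease of f at step k
    relative to |g_k|^2. *)
Definition gain i0 k w : R :=
  enorm (rmx (P k) w *m unit_grad i0 k w) ^+ 2 * \1_(good k) w.

(** The Laplace transform of a chi-square variable, increased by the bound on
    the probability that a step is not good. *)
Definition kappa : R := (Num.sqrt 2)^-1 ^+ s + 2 * expR (- s%:R).

Let kappa_ge0 : 0 <= kappa.
Proof. by rewrite addr_ge0 ?exprn_ge0 ?invr_ge0 ?sqrtr_ge0 // mulr_ge0 // expR_ge0. Qed.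

Lemma measurable_gain i0 k :
  measurable_fun setT (gain i0 k : info X (past k.+1) -> R).
Proof.
have mP : @measurable_mx _ (info X (past k.+1)) R _ _ (rmx (P k)).
  by move=> i j; exact: (@lift_present k (fun w => rmx (P k) w i j) (@measurable_sketch k i j)).
have mu : @measurable_mx _ (info X (past k.+1)) R _ _ (unit_grad i0 k).
  by move=> i j; exact: (@lift_past k (fun w => unit_grad i0 k w i j) (@measurable_unit_grad i0 k i j)).
apply: measurable_funM.
  by apply: measurable_funX; apply: measurable_enorm; exact: measurable_mxM.
apply: lift_present.
by apply: measurable_indic; exact: measurable_good.
Qed.

Definition total_gain i0 k w : R := \sum_(j < k) gain i0 j w.

Lemma measurable_total_gain i0 k :
  measurable_fun setT (total_gain i0 k : info X (past k) -> R).
Proof.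
elim: k => [|k ih].
  have -> : total_gain i0 0 = fun=> 0 by apply/funext => w; rewrite /total_gain big_ord0.
  exact: measurable_cst.
have -> : total_gain i0 k.+1 = fun w => total_gain i0 k w + gain i0 k w.
  by apply/funext => w; rewrite /total_gain big_ord_recr.
apply: measurable_funD; last exact: measurable_gain.
exact: lift_past.
Qed.

(** Conditionally on the past, the exponential moment of the gain of step k is
    at most kappa: decoupling freezes the direction, and the fresh Gaussian
    matrix contributes its Laplace transform plus the probability that its
    Gram matrix is large. *)
Lemma exp_moment_step i0 k :
  (\int[Pr]_w (expR (- (s%:R / 2 * total_gain i0 k.+1 w)))%:E <=
   kappa%:E * \int[Pr]_w (expR (- (s%:R / 2 * total_gain i0 k w)))%:E)%E.
Proof.
pose a w := expR (- (s%:R / 2 * total_gain i0 k w)).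
pose b w v := expR (- (s%:R / 2 * enorm (rmx (P k) v *m unit_grad i0 k w) ^+ 2)) +
  \1_(~` good k) v.
have a0 w : 0 <= a w by exact: expR_ge0.
have b0 w v : 0 <= b w v by rewrite addr_ge0 ?expR_ge0.
have ma : measurable_fun setT (a : info X (past k) -> R).
  apply: measurableT_comp => //; apply: measurable_funN; apply: measurable_funM => //.
  exact: measurable_total_gain.
pose E (z : (info X (past k) * info X (present k))%type) :=
  expR (- (s%:R / 2 * enorm (rmx (P k) z.2 *m unit_grad i0 k z.1) ^+ 2)).
have mE : measurable_fun setT E.
  apply: measurableT_comp => //; apply: measurable_funN; apply: measurable_funM => //.
  apply: measurable_funX; apply: measurable_enorm; apply: measurable_mxM => i j.
    exact: (measurableT_comp (@measurable_sketch k i j) measurable_snd).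
  exact: (measurableT_comp (@measurable_unit_grad i0 k i j) measurable_fst).
have mbad : measurable_fun setT (\1_(~` good k) : info X (present k) -> R).
  by apply: measurable_indic; apply: measurableC; exact: measurable_good.
pose F (z : (info X (past k) * info X (present k))%type) := (a z.1 * b z.1 z.2)%:E.
have mF : measurable_fun setT F.
  apply/measurable_EFinP; apply: measurable_funM.
    exact: (measurableT_comp ma measurable_fst).
  apply: measurable_funD => //.
  exact: (measurableT_comp mbad measurable_snd).
have F0 z : (0 <= F z)%E by rewrite lee_fin mulr_ge0.
apply: (@le_trans _ _ (\int[Pr]_w F (w, w))%E).
  apply: ge0_le_integral => //.
  - apply/measurable_EFinP; apply: measurableT_comp => //; apply: measurable_funN.
    apply: measurable_funM => //.
    exact: (@measurable_from_info _ _ _ _ _ X (past k.+1) _ _ _ (@measurable_total_gain i0 k.+1)).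
  - exact: (measurableT_comp mF (@measurable_diagonal _ _ _ _ _ X (past k) (present k))).
  - move=> w _; rewrite lee_fin /F /=.
    have -> : total_gain i0 k.+1 w = total_gain i0 k w + gain i0 k w.
      by rewrite /total_gain big_ord_recr.
    rewrite mulrDr opprD expRD ler_wpM2l // /b /gain !indicE in_setC.
    case: (w \in good k) => /=; first by rewrite mulr1 addr0.
    by rewrite mulr0 mulr0 oppr0 expR0 lerDr expR_ge0.
rewrite (@decoupling _ _ _ _ _ X P_gauss.2 _ _ F (past_present k) mF F0).
have ma' : measurable_fun setT a.
  exact: (@measurable_from_info _ _ _ _ _ X (past k) _ _ _ ma).
have inner w : (\int[Pr]_v F (w, v) <= kappa%:E * (a w)%:E)%E.
  have mEw : measurable_fun setT (fun v =>
      expR (- (s%:R / 2 * enorm (rmx (P k) v *m unit_grad i0 k w) ^+ 2))).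
    apply: measurableT_comp => //; apply: measurable_funN; apply: measurable_funM => //.
    apply: measurable_funX; apply: measurable_enorm; apply: measurable_mxM => i j.
      exact: (@measurable_from_info _ _ _ _ _ X (present k) _ _ _ (@measurable_sketch k i j)).
    exact: measurable_cst.
  have mbad' : measurable_fun setT (\1_(~` good k) : T -> R).
    by apply: measurable_indic; exact: measurableC.
  have mb : measurable_fun setT (b w) by exact: measurable_funD.
  have -> : (\int[Pr]_v F (w, v) = (a w)%:E * \int[Pr]_v (b w v)%:E)%E.
    rewrite /F /=; under eq_integral do rewrite EFinM.
    by rewrite ge0_integralZl //; [exact/measurable_EFinP|move=> v _; rewrite lee_fin|rewrite lee_fin].
  rewrite muleC lee_wpmul2r ?lee_fin //.
  have -> : (\int[Pr]_v (b w v)%:E = ((Num.sqrt 2)^-1 ^+ s)%:E + Pr (~` good k))%E.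
    rewrite /b; under eq_integral do rewrite EFinD.
    rewrite ge0_integralD //.
    - rewrite laplace_sketch ?unit_grad1 // integral_indic ?setIT //.
      exact: measurableC.
    - exact/measurable_EFinP.
    - exact/measurable_EFinP.
  by rewrite /kappa EFinD leeD2l // bad_prob.
apply: (@le_trans _ _ (\int[Pr]_w (kappa%:E * (a w)%:E))%E); last first.
  by rewrite ge0_integralZl //; [exact/measurable_EFinP|move=> w _; rewrite lee_fin].
apply: ge0_le_integral => //.
- by move=> w _; exact: integral_ge0.
- exact: measurable_partial_integral.
- apply: emeasurable_funM => //; exact/measurable_EFinP.
Qed.

Lemma measurable_total_gainT i0 m : measurable_fun setT (total_gain i0 m).
Proof.
exact: (@measurable_from_info _ _ _ _ _ X (past m) _ _ _ (@measurable_total_gain i0 m)).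
Qed.

Lemma exp_moment_total i0 m :
  (\int[Pr]_w (expR (- (s%:R / 2 * total_gain i0 m w)))%:E <= (kappa ^+ m)%:E)%E.
Proof.
elim: m => [|m ih].
  rewrite expr0 (eq_integral (fun=> 1%E)) => [|w _]; last first.
    by rewrite /total_gain big_ord0 mulr0 oppr0 expR0.
  by rewrite integral_cst // mul1e probability_le1.
apply: le_trans (exp_moment_step i0 m) _.
by rewrite exprS EFinM lee_wpmul2l // lee_fin.
Qed.

(** Chernoff's bound at the exponent s/2, the optimal one for the lower tail
    of a chi-square variable at half of its mean. *)
Lemma total_gain_tail i0 m : (6 <= s)%N ->
  (Pr [set w | (total_gain i0 m w <= m%:R / 2)%R] <= (expR (- (m%:R / 2)))%:E)%E.
Proof.
move=> s6; set N := [set w | _].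
have mN : measurable N.
  by apply: measurable_set_le => //; exact: measurable_total_gainT.
pose c : R := expR (s%:R / 4).
have c0 : 0 < c by exact: expR_gt0.
have mexp : measurable_fun setT (fun w => expR (- (s%:R / 2 * total_gain i0 m w))).
  apply: measurableT_comp => //; apply: measurable_funN; apply: measurable_funM => //.
  exact: measurable_total_gainT.
have markov : (Pr N <= (c ^+ m)%:E * (kappa ^+ m)%:E)%E.
  apply: (@le_trans _ _ ((c ^+ m)%:E *
      \int[Pr]_w (expR (- (s%:R / 2 * total_gain i0 m w)))%:E)%E); last first.
    by apply: lee_wpmul2l (exp_moment_total i0 m); rewrite lee_fin exprn_ge0 // ltW.
  rewrite ge0_integral_scale ?exprn_ge0 ?(ltW c0) //.
  have -> : Pr N = (\int[Pr]_w (\1_N w)%:E)%E by rewrite integral_indic // setIT.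
  apply: ge0_le_integral => //.
  - exact/measurable_EFinP/measurable_indic.
  - by apply/measurable_EFinP; exact: measurable_funM.
  - move=> w _; rewrite lee_fin indicE.
    have [|_] := boolP (w \in N); last by rewrite mulr_ge0 ?exprn_ge0 ?expR_ge0.
    rewrite inE /N /= => tg; rewrite /c -expRM_natr -expRD -[leLHS]expR0 ler_expR.
    have -> : s%:R / 4 * m%:R - s%:R / 2 * total_gain i0 m w =
      s%:R / 2 * (m%:R / 2 - total_gain i0 m w) by field.
    by rewrite mulr_ge0 ?divr_ge0 // subr_ge0.
apply: le_trans markov _; rewrite -EFinM lee_fin -exprMn.
have -> : expR (- (m%:R / 2)) = expR (- (1 / 2)) ^+ m :> R.
  by rewrite -expRM_natr; congr expR; field.
apply: lerXn2r; rewrite ?nnegrE ?expR_ge0 ?mulr_ge0 ?(ltW c0) //.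
exact: chernoff_rate.
Qed.

End Iteration.

(** * Conclusion *)

Lemma measurable_bigmin d (T : measurableType d) (R : realType) (I : Type)
    (r : seq I) (g0 : T -> R) (g : I -> T -> R) :
  measurable_fun setT g0 -> (forall i, measurable_fun setT (g i)) ->
  measurable_fun setT (fun w => \big[Num.min/g0 w]_(i <- r) g i w).
Proof.
move=> mg0 mg; elim: r => [|i r ih].
  by under eq_fun do rewrite big_nil.
under eq_fun do rewrite big_cons.
exact: measurable_minr.
Qed.

Section Descent.
Context {R : realType} {n s : nat}.
Context {f : 'cV[R]_n -> R} {x0 : 'cV[R]_n} {gamma c1 c2 alpha beta : R}.
Hypothesis f_C2 : twice_continuously_differentiable f.
Hypotheses (c1_gt1 : 1 < c1) (c2_gt0 : 0 < c2).
Hypotheses (alpha_gt0 : 0 < alpha) (beta_gt0 : 0 < beta).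
Context {P : nat -> 'M[R]_(s, n)} {x : nat -> 'cV[R]_n}.
Hypothesis x_alg : rs_rnm f gamma c1 c2 alpha beta x0 P x.

(** M_k is positive definite for any P_k, so Armijo's rule is applied to a
    direction of descent. *)
Lemma objective_decreases k : f (x k.+1) <= f (x k).
Proof.
have [_ /(_ k)[l [arm _] ->]] := x_alg.
rewrite -subr_ge0; apply: le_trans arm.
rewrite oppr_ge0 mulr_ge0_le0 ?mulr_ge0 ?exprn_ge0 ?(ltW alpha_gt0) ?(ltW beta_gt0) //.
have [g0|g0] := eqVneq (grad f (x k)) 0; first by rewrite g0 /dot linear0 mul0mx mxE.
exact: direction_descent f_C2 c1_gt1 c2_gt0 (P k) (x k) g0.
Qed.

Lemma iterate_in_level k : level_set f x0 (x k).
Proof.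
rewrite /level_set /=; elim: k => [|k ih]; first by have [-> _] := x_alg.
by apply: le_trans ih; exact: objective_decreases.
Qed.

End Descent.

(** As f is bounded below on the compact level set, inf is the true infimum. *)
Lemma level_set_fstar_le (R : realType) (n : nat) (f : 'cV[R]_n -> R) x0 y :
  twice_continuously_differentiable f -> bounded_set (level_set f x0) ->
  level_set f x0 y -> inf (f @` level_set f x0) <= f y.
Proof.
move=> f_C2 bO Oy.
have cf : continuous f by move=> z; apply: differentiable_continuous; case: f_C2.
have cO : compact (level_set f x0).
  apply: bounded_closed_compact_cV => //.
  rewrite (_ : level_set f x0 = f @^-1` [set t | t <= f x0]) //.
  by apply: closed_comp => [z _|]; [exact: cf|exact: closed_le].
have [|z _ zmin] := compact_EVT_min _ cO (continuous_subspaceT cf); first by exists y.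
apply: ge_inf; last by exists y.
by exists (f z) => _ [t Ot <-]; apply: zmin; rewrite inE.
Qed.

Unset Implicit Arguments.

Theorem theorem4p11 (R : realType) (n s : nat) (s_gt0 : (0 < s)%N)
  (s_lt_n : (s < n)%N)
  (f : 'cV[R]_n -> R) (f_C2 : twice_continuously_differentiable f)
  (x0 : 'cV[R]_n) (gamma c1 c2 alpha beta : R)
  (gamma_ge0 : 0 <= gamma) (c1_gt1 : 1 < c1) (c2_gt0 : 0 < c2)
  (alpha_gt0 : 0 < alpha) (alpha_lt1 : alpha < 1)
  (beta_gt0 : 0 < beta) (beta_lt1 : beta < 1)
  (d : measure_display) (T : measurableType d) (Pr : probability T R)
  (P : nat -> 'I_s -> 'I_n -> {RV Pr >-> R}) (P_gauss : gaussian_mx_seq P)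
  (x : nat -> T -> 'cV[R]_n)
  (x_alg : forall w, rs_rnm f gamma c1 c2 alpha beta x0
                       (fun k => rmx (P k) w) (fun k => x k w))
  (C0 Cbar : R) (C0_spec : embedding_constant C0)
  (Cbar_spec : gram_norm_constant s n Cbar)
  (Omega_bounded : bounded_set (level_set f x0))
  (Ug : R) (Ug_gt0 : 0 < Ug)
  (Ug_bound : forall k w, enorm (grad f (x k w)) <= Ug)
  (gamma_le_half : gamma <= 1 / 2) (alpha_le_half : alpha <= 1 / 2)
  (LH : R) (LH_gt0 : 0 < LH)
  (LH_lip : forall y z,
     add_ball (level_set f x0) (radius1 n s gamma c2 Cbar Ug) y ->
     add_ball (level_set f x0) (radius1 n s gamma c2 Cbar Ug) z ->
     opnorm (hessian f y - hessian f z) <= LH * enorm (y - z))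
  (UH : R) (UH_gt0 : 0 < UH)
  (UH_bound : forall y,
     add_ball (level_set f x0) (radius1 n s gamma c2 Cbar Ug) y ->
     opnorm (hessian f y) <= UH)
  (delta eps : R) (delta_gt0 : 0 < delta) (delta_lt1 : delta < 1)
  (eps_gt0 : 0 < eps) :
  let fstar := inf (f @` level_set f x0) in
  let p := pconst n s gamma c1 c2 alpha beta Cbar Ug UH LH in
  let ds := delta_s s C0 in
  forall m : nat,
  m%:Z = Num.floor ((f x0 - fstar) /
                    ((1 - delta) * (1 - ds) * p * eps ^+ 2)) + 1 ->
  ((1 - expR (- (delta ^+ 2 / 2 * (1 - ds) * m%:R)))%:E <=
   Pr [set w | (\big[Num.min/enorm (grad f (x 0%N w))]_(k < m)
                 enorm (grad f (x k w))
               <= Num.sqrt ((f x0 - fstar) / (m%:R * p)))%R])%E.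
Proof.
move=> fstar p ds m _.
set mu := 1 - ds.
have Pge0 (A : set T) : (0 <= Pr A)%E by exact: measure_ge0.
have trivial_case : 1 <= expR (- (delta ^+ 2 / 2 * mu * m%:R)) -> forall A : set T,
    ((1 - expR (- (delta ^+ 2 / 2 * mu * m%:R)))%:E <= Pr A)%E.
  by move=> h A; apply: le_trans (Pge0 A); rewrite lee_fin subr_le0.
have d20 : 0 <= delta ^+ 2 / 2 by rewrite divr_ge0 ?sqr_ge0.
(* If 1 - delta_s <= 0 the announced probability is not positive. *)
have [mu_le0|mu_gt0] := leP mu 0.
  apply: trivial_case; rewrite -[leLHS]expR0 ler_expR oppr_ge0.
  by rewrite mulr_le0_ge0 // mulr_ge0_le0.
have [->|m_neq0] := eqVneq m 0%N.
  by apply: le_trans (Pge0 _); rewrite mulr0 oppr0 expR0 subrr.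
have m_gt0 : 0 < m%:R :> R by rewrite ltr0n lt0n.
have n_gt0 : (0 < n)%N by rewrite (leq_trans _ s_lt_n).
pose i0 : 'I_n := Ordinal n_gt0; pose r0 : 'I_s := Ordinal s_gt0.
have sR_gt0 : 0 < s%:R :> R by rewrite ltr0n.
have sig0 : 0 < (Num.sqrt (s%:R : R))^-1 by rewrite invr_gt0 sqrtr_gt0.
(* One fixed entry of each of the matrices P k forms an infinite i.i.d.
   sequence, which provides chi-square variables of every degree. *)
have s6 : (6 <= s)%N.
  have inj : injective (fun k : nat => (k, (r0, i0))) by move=> a b [].
  exact: (embedding_dim_ge6 (iid_normal_reindex inj P_gauss) sig0 C0_spec mu_gt0).
have Cbar_gt0 : 0 < Cbar by case: Cbar_spec.
pose G k w := enorm (grad f (x k w)).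
pose S w := @total_gain _ _ _ Pr n s P x f Cbar i0 m w.
pose c := (f x0 - fstar) / (m%:R * p).
pose Bad := [set w | S w <= m%:R / 2].
pose Good := [set w | \big[Num.min/G 0%N w]_(k < m) G k w <= Num.sqrt c].
have mG k : measurable_fun setT (G k).
  apply: measurable_enorm; apply: (measurable_grad f_C2) => i j.
  exact: (measurable_from_info (@measurable_iterate _ _ _ Pr n s P x f x0 gamma c1 c2 alpha beta
    s_gt0 f_C2 x_alg k i j)).
have mGood : measurable Good.
  by apply: measurable_set_le => //; exact: measurable_bigmin.
have mBad : measurable Bad.
  apply: measurable_set_le => //.
  exact: (measurable_total_gainT s_gt0 f_C2 x_alg Cbar_spec i0 m).
have tmin_gt0 : 0 < tmin n s gamma c2 beta Cbar Ug LH.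
  rewrite /tmin lt_min ltr01 /=; apply: divr_gt0.
    by rewrite !mulr_gt0 // exprn_gt0.
  apply: mulr_gt0; last by rewrite exprn_gt0 // ltr0n.
  by apply: mulr_gt0; [rewrite mulr_gt0 // exprn_gt0|rewrite powR_gt0].
have p_gt0 : 0 < p.
  apply: divr_gt0; first exact: mulr_gt0.
  apply: addr_gt0; last by rewrite !mulr_gt0 // powR_gt0.
  have nR : 0 < n%:R :> R by rewrite ltr0n.
  have c1p : 0 < 1 + c1 by rewrite addr_gt0 // (lt_trans ltr01).
  by rewrite mulr_gt0 // mulr_gt0 ?divr_gt0 // !mulr_gt0.
have p2_gt0 : 0 < 2 * p := mulr_gt0 (ltr0Sn R 1) p_gt0.
have gain_ge0 k w : 0 <= @gain _ _ _ Pr n s P x f Cbar i0 k w.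
  by rewrite /gain mulr_ge0 ?sqr_ge0.
have step k w : 2 * p * (@gain _ _ _ Pr n s P x f Cbar i0 k w * G k w ^+ 2) <=
    f (x k w) - f (x k.+1 w).
  have dec := objective_decreases f_C2 c1_gt1 c2_gt0 alpha_gt0 beta_gt0 (x_alg w) k.
  have [g0|g0] := eqVneq (grad f (x k w)) 0.
    by rewrite /G g0 enorm0 expr0n /= !mulr0 subr_ge0.
  rewrite /gain indicE; case: (boolP (w \in _)) => [|_]; last first.
    by rewrite mulr0 mul0r mulr0 subr_ge0.
  rewrite inE /= => good; rewrite mulr1.
  have [l arm ->] := (x_alg w).2 k.
  have xO := iterate_in_level f_C2 c1_gt1 c2_gt0 alpha_gt0 beta_gt0 (x_alg w) k.
  have := step_decrease s_gt0 s_lt_n f_C2 gamma_ge0 c1_gt1 c2_gt0 alpha_gt0 beta_gt0 beta_lt1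
    Cbar_gt0 Ug_gt0 gamma_le_half alpha_le_half LH_gt0 UH_gt0 LH_lip UH_bound g0 xO good
    (Ug_bound k w) arm.
  apply: le_trans; rewrite le_eqVlt; apply/orP; left; apply/eqP; congr (_ * _).
  by rewrite -{1}(unit_gradK i0 k w) -scalemxAr enormZ exprMn ger0_norm ?enorm_ge0 // mulrC.
have fstar_le k w : fstar <= f (x k w).
  apply: (level_set_fstar_le f_C2 Omega_bounded).
  by have := iterate_in_level f_C2 c1_gt1 c2_gt0 alpha_gt0 beta_gt0 (x_alg w) k.
have total w : 2 * p * \sum_(k < m) @gain _ _ _ Pr n s P x f Cbar i0 k w * G k w ^+ 2 <=
    f x0 - fstar.
  apply: (@le_trans _ _ (f x0 - f (x m w))); last by rewrite lerD2l lerN2.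
  elim: m {m_neq0 m_gt0 S c Bad Good mGood mBad trivial_case} => [|j ih].
    by rewrite big_ord0 mulr0 (x_alg w).1 subrr.
  rewrite big_ord_recr mulrDr /=; apply: le_trans (lerD ih (step j w)) _.
  by rewrite addrA subrK.
have D_ge0 : 0 <= f x0 - fstar.
  by rewrite subr_ge0; apply: (level_set_fstar_le f_C2 Omega_bounded); rewrite /level_set /=.
have c_ge0 : 0 <= c by rewrite divr_ge0 // mulr_ge0 // ltW.
have DE : f x0 - fstar = m%:R * p * c.
  by rewrite /c mulrC divfK // mulf_neq0 // gt_eqF.
(* Since D = m p c, the bound 2 p c S <= D on the failure event is S <= m / 2.
   This needs c > 0; if c = 0 the gradients are nonzero and the gains all
   vanish. *)
have fail w : ~ Good w -> Bad w.
  move=> /negP; rewrite -ltNge => /bigmin_gtP[_ Gk].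
  have cG (k : 'I_m) : c < G k w ^+ 2.
    rewrite -[c]sqr_sqrtr // ltrXn2r // ?nnegrE ?sqrtr_ge0 ?enorm_ge0 //.
    exact: Gk.
  have SE : S w = \sum_(k < m) @gain _ _ _ Pr n s P x f Cbar i0 k w by [].
  have := total w; rewrite DE => tot.
  have cS : c * S w <= \sum_(k < m) @gain _ _ _ Pr n s P x f Cbar i0 k w * G k w ^+ 2.
    rewrite SE mulr_sumr; apply: ler_sum => k _.
    by rewrite mulrC ler_wpM2l // ltW.
  rewrite /Bad /=; have [c0|c_neq0] := eqVneq c 0.
    rewrite c0 mulr0 (pmulr_rle0 _ p2_gt0) in tot.
    have pos (k : 'I_m) : true ->
        0 <= @gain _ _ _ Pr n s P x f Cbar i0 k w * G k w ^+ 2.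
      by rewrite mulr_ge0 ?sqr_ge0.
    have z : \sum_(k < m) @gain _ _ _ Pr n s P x f Cbar i0 k w * G k w ^+ 2 = 0.
      by apply/eqP; rewrite eq_le tot sumr_ge0.
    rewrite SE big1 ?divr_ge0 // => k _; apply/eqP.
    have /eqP : @gain _ _ _ Pr n s P x f Cbar i0 k w * G k w ^+ 2 = 0.
      exact: (psumr_eq0P pos z).
    by rewrite mulf_eq0 orbC gt_eqF // -c0.
  have c_gt0 : 0 < c by rewrite lt0r c_neq0.
  rewrite -(ler_pM2l c_gt0); apply: le_trans cS _.
  rewrite -(ler_pM2l p2_gt0); apply: le_trans tot _.
  by rewrite le_eqVlt; apply/orP; left; apply/eqP; field.
have PBad : (Pr Bad <= (expR (- (m%:R / 2)))%:E)%E.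
  exact: (total_gain_tail s_gt0 f_C2 P_gauss x_alg Cbar_spec i0 m s6).
have PGood : (1 - Pr Bad <= Pr Good)%E.
  rewrite -probability_setC //; apply: le_measure; rewrite ?inE //.
    exact: measurableC.
  by move=> w nB; apply: contrapT => nG; exact/nB/fail.
rewrite -/(G 0%N) -/Good; apply: le_trans PGood.
rewrite -(fineK (fin_num_measure Pr _ mBad)) in PBad *.
rewrite lee_fin in PBad; rewrite -EFinB lee_fin lerD2l lerN2.
apply: le_trans PBad _; rewrite ler_expR lerN2.
have mu1 : mu <= 1.
  by rewrite /mu gerBl /ds /delta_s mulr_ge0 // addr_ge0 // expR_ge0.
have d21 : delta ^+ 2 <= 1 by rewrite expr_le1 // ltW.
rewrite [leRHS]mulrC ler_wpM2r ?ler0n //.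
by rewrite mulrAC ler_piMl ?invr_ge0 // mulr_ile1 ?sqr_ge0 // ltW.
Qed.
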